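(* Let $(M,g,J)$ be a compact balanced manifold, with $g=\langle\cdot,\cdot\rangle$. Then, pointwise on $M$, $$\Big|S-\sum_{i,j}\langle R(e_{i}, e_{j})Je_{i}, Je_{j}\rangle\Big|\leq |\nabla J|^{2},$$ where $S$ denotes the scalar curvature of $g$ and $\{e_i\}$ is any local orthonormal frame.
   Context: An almost-Hermitian manifold is a smooth manifold $M$ with an almost complex structure $J$ (a smooth section of $\mathrm{Hom}(TM,TM)$ with $J^2=-\mathrm{id}$) and a Riemannian metric $g$ compatible with $J$, i.e. $\langle JX,JY\rangle=\langle X,Y\rangle$ for all $X,Y$. It is a balanced manifold if $J$ is integrable (i.e. induced by a complex manifold structure; equivalently its Nijenhuis tensor vanishes) and $d(\omega^{m-1})=0$, where $2m=\dim_{\mathbb{R}}M$, $\omega(X,Y)=\langle X,JY\rangle$, $\omega^{m-1}$ is the $(m-1)$-fold wedge power and $d$ is the exterior derivative. $\nabla$ is the Levi-Civita connection, $(\nabla_XJ)Y=\nabla_X(JY)-J\nabla_XY$, $|\nabla J|^2=\sum_{i,j}|(\nabla_{e_i}J)e_j|^2$, and the curvature tensor has the sign convention $R(X,Y)=-\nabla_X\nabla_Y+\nabla_Y\nabla_X+\nabla_{[X,Y]}$, so that $S=\sum_{i,j}\langle R(e_i,e_j)e_i,e_j\rangle$. *)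

(* Defs.v *)
From HB Require Import structures.
From mathcomp Require Import all_boot all_order all_algebra perm.
From mathcomp Require Import all_classical all_reals all_analysis.

Set Implicit Arguments.
Unset Strict Implicit.
Unset Printing Implicit Defensive.

Import Order.TTheory GRing.Theory Num.Theory.
Import numFieldNormedType.Exports.

Local Open Scope classical_set_scope.
Local Open Scope ring_scope.

(* C^infinity on U (used with U open), for maps R^n -> W: every iterated
   directional derivative is (Frechet) differentiable, hence continuous, at
   every point of U. *)
Definition smooth_on (R : realType) (n : nat) (W : normedModType R)
    (U : set 'rV[R]_n) (f : 'rV[R]_n -> W) : Prop :=
  forall (s : seq 'rV[R]_n) (x : 'rV[R]_n), U x ->
    differentiable (foldr (fun v h => 'D_v h : 'rV[R]_n -> W) f s) x.

Record smoothManifold (R : realType) (n : nat) := SmoothManifold {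
  mfd_space :> topologicalType;
  mfd_hausdorff : hausdorff_space mfd_space;
  mfd_second_countable : @second_countable mfd_space;
  chart : Type;
  chart_dom : chart -> set mfd_space;
  chart_map : chart -> mfd_space -> 'rV[R]_n;
  chart_inv : chart -> 'rV[R]_n -> mfd_space;
  chart_dom_open : forall a, open (chart_dom a);
  chart_cover : forall p, exists a, chart_dom a p;
  chart_img_open : forall a, open (chart_map a @` chart_dom a);
  chart_mapK : forall a p, chart_dom a p -> chart_inv a (chart_map a p) = p;
  chart_map_continuous : forall a, {within chart_dom a, continuous (chart_map a)};
  chart_inv_continuous : forall a,
    {within chart_map a @` chart_dom a, continuous (chart_inv a)};
  chart_smooth : forall a b,
    smooth_on (chart_map a @` (chart_dom a `&` chart_dom b))
              (chart_map b \o chart_inv a)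
}.

Definition chart_img (R : realType) (n : nat) (M : smoothManifold R n)
  (a : chart M) : set 'rV[R]_n := chart_map a @` chart_dom a.

(* A tangent vector at p is represented in the chart a by a row vector v; in the
   chart b the same vector is v *m transition_jac a b p. *)
Definition transition_jac (R : realType) (n : nat) (M : smoothManifold R n)
    (a b : chart M) (p : M) : 'M[R]_n :=
  jacobian (chart_map b \o chart_inv a) (chart_map a p).

Definition inner (R : realType) (n : nat) (G : 'M[R]_n) (u v : 'rV[R]_n) : R :=
  (u *m G *m v^T) 0 0.

(* Tensor fields are families of coordinate expressions, one per chart, subject
   to the usual transformation rule on overlaps.  Endomorphisms of the tangent
   space act on the right: J u is u *m acs a x. *)
Record almostHermitian (R : realType) (m : nat) := AlmostHermitian {
  ah_mfd :> smoothManifold R m.*2;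

  metric : chart ah_mfd -> 'rV[R]_(m.*2) -> 'M[R]_(m.*2);
  metric_smooth : forall a, smooth_on (chart_img a) (metric a);
  metric_sym : forall a (x u v : 'rV[R]_(m.*2)), chart_img a x ->
    inner (metric a x) u v = inner (metric a x) v u;
  metric_pos : forall a (x u : 'rV[R]_(m.*2)), chart_img a x -> u != 0 ->
    0 < inner (metric a x) u u;
  metric_transition : forall a b p, chart_dom a p -> chart_dom b p ->
    metric a (chart_map a p) =
    transition_jac a b p *m metric b (chart_map b p) *m (transition_jac a b p)^T;

  acs : chart ah_mfd -> 'rV[R]_(m.*2) -> 'M[R]_(m.*2);
  acs_smooth : forall a, smooth_on (chart_img a) (acs a);
  acs_square : forall a (x u : 'rV[R]_(m.*2)), chart_img a x ->
    (u *m acs a x) *m acs a x = - u;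
  acs_transition : forall a b p, chart_dom a p -> chart_dom b p ->
    acs a (chart_map a p) *m transition_jac a b p =
    transition_jac a b p *m acs b (chart_map b p);

  metric_acs : forall a (x u v : 'rV[R]_(m.*2)), chart_img a x ->
    inner (metric a x) (u *m acs a x) (v *m acs a x) = inner (metric a x) u v
}.

Section ChartCalculus.
Context (R : realType) (n : nat).

Definition vfield := 'rV[R]_n -> 'rV[R]_n.

Definition endo (J : 'rV[R]_n -> 'M[R]_n) (X : vfield) : vfield :=
  fun x => X x *m J x.

Definition lie_bracket (X Y : vfield) : vfield :=
  fun x => 'D_(X x) Y x - 'D_(Y x) X x.

Definition nijenhuis (J : 'rV[R]_n -> 'M[R]_n) (X Y : vfield) : vfield :=
  fun x => lie_bracket (endo J X) (endo J Y) x
         - endo J (lie_bracket (endo J X) Y) x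
         - endo J (lie_bracket X (endo J Y)) x
         - lie_bracket X Y x.

(* <Gamma(u, v), w> = (D_u g (v, w) + D_v g (u, w) - D_w g (u, v)) / 2 *)
Definition christoffel (G : 'rV[R]_n -> 'M[R]_n) (x u v : 'rV[R]_n) : 'rV[R]_n :=
  (\row_l (2^-1 * (inner ('D_u G x) v (delta_mx 0 l)
                   + inner ('D_v G x) u (delta_mx 0 l)
                   - inner ('D_(delta_mx 0 l) G x) u v)))
  *m invmx (G x).

Definition levi_civita (G : 'rV[R]_n -> 'M[R]_n) (X Y : vfield) : vfield :=
  fun x => 'D_(X x) Y x + christoffel G x (X x) (Y x).

Definition nabla_endo (G J : 'rV[R]_n -> 'M[R]_n) (X Y : vfield) : vfield :=
  fun x => levi_civita G X (endo J Y) x - endo J (levi_civita G X Y) x.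

Definition curvature (G : 'rV[R]_n -> 'M[R]_n) (X Y Z : vfield) : vfield :=
  fun x => - levi_civita G X (levi_civita G Y Z) x
           + levi_civita G Y (levi_civita G X Z) x
           + levi_civita G (lie_bracket X Y) Z x.

Definition dform (k : nat) := 'rV[R]_n -> ('I_k -> 'rV[R]_n) -> R.

Definition wedge (p q : nat) (alpha : dform p) (beta : dform q) : dform (p + q) :=
  fun x v => (p`! * q`!)%N%:R^-1 *
    \sum_(s : 'S_(p + q)) (-1) ^+ s
      * alpha x (fun i => v (s (lshift q i)))
      * beta x (fun j => v (s (rshift p j))).

Fixpoint wedge_pow (omega : dform 2) (k : nat) : dform k.*2 :=
  if k is k'.+1 then wedge omega (@wedge_pow omega k') else fun _ _ => 1.

(* Invariant formula for d on the constant extensions of the v i, whose brackets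
   vanish. *)
Definition ext_d (k : nat) (alpha : dform k) : dform k.+1 :=
  fun x v => \sum_(i < k.+1) (-1) ^+ i *
    ('D_(v i) (fun y => alpha y (fun j => v (lift i j)) : R^o) x : R).

Definition fundamental_form (G J : 'rV[R]_n -> 'M[R]_n) : dform 2 :=
  fun x v => inner (G x) (v ord0) (v ord_max *m J x).

End ChartCalculus.

Arguments wedge_pow {R n} omega k.

Definition integrable_acs (R : realType) (m : nat) (M : almostHermitian R m)
    : Prop :=
  forall (a : chart M) (U : set M) (X Y : vfield R m.*2),
    open U -> U `<=` chart_dom a ->
    smooth_on (chart_map a @` U) X -> smooth_on (chart_map a @` U) Y ->
    forall p, U p -> nijenhuis (acs a) X Y (chart_map a p) = 0.

Definition balanced (R : realType) (m : nat) (M : almostHermitian R m) : Prop :=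
  integrable_acs M /\
  forall (a : chart M) (p : M), chart_dom a p ->
    forall v, ext_d (wedge_pow (fundamental_form (metric a) (acs a)) m.-1)
                    (chart_map a p) v = 0.

(* A local orthonormal frame over U, in the coordinates of the chart a. *)
Definition orthonormal_frame (R : realType) (m : nat) (M : almostHermitian R m)
    (a : chart M) (U : set M) (e : 'I_(m.*2) -> vfield R m.*2) : Prop :=
  (forall i, smooth_on (chart_map a @` U) (e i)) /\
  (forall p i j, U p ->
     inner (metric a (chart_map a p)) (e i (chart_map a p)) (e j (chart_map a p))
     = (i == j)%:R).

Section FrameSums.
Context (R : realType) (m : nat) (M : almostHermitian R m) (a : chart M).
Context (e : 'I_(m.*2) -> vfield R m.*2) (p : M).

Let x := chart_map a p.
Let g := inner (metric a x).

Definition scalar_curvature : R :=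
  \sum_i \sum_j g (curvature (metric a) (e i) (e j) (e i) x) (e j x).

Definition star_scalar_curvature : R :=
  \sum_i \sum_j
    g (curvature (metric a) (e i) (e j) (endo (acs a) (e i)) x)
      (endo (acs a) (e j) x).

Definition nabla_acs_sqnorm : R :=
  \sum_i \sum_j
    g (nabla_endo (metric a) (acs a) (e i) (e j) x)
      (nabla_endo (metric a) (acs a) (e i) (e j) x).

End FrameSums.

(* Main.v *)
Require Import Defs.
From HB Require Import structures.
From mathcomp Require Import all_boot all_order all_algebra perm.
From mathcomp Require Import all_classical all_reals all_analysis.
From mathcomp Require Import ring lra.
Import Order.TTheory GRing.Theory Num.Theory.
Import numFieldNormedType.Exports.
Local Open Scope classical_set_scope.
Local Open Scope ring_scope.

Set Implicit Arguments.
Unset Strict Implicit.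
Unset Printing Implicit Defensive.

(** Write [N_u v] for [(nabla_u J) v]; it is skew for [g] and anticommutes with
    [J].

    The power [omega^(m-1)] evaluated on the vectors of a basis other than
    [v_a, v_j] is, up to sign and a constant, the cofactor [P_aj] of the Pfaffian
    of [W_ij = omega(v_i, v_j)], and [W P^T] is a multiple of the identity.
    Closedness says that [P] is divergence free; differentiating [W P^T = f]
    turns this into the vanishing of the trace of [d omega] against the inverse
    of [omega], which is the statement [sum_i N_{e_i} e_i = 0].

    The Ricci identity expresses [R(X,Y) J - J R(X,Y)] by second derivatives of
    [J].  Contracting it with an orthonormal frame and differentiating the two
    traces [sum_i N_{e_i} e_i = 0] and [sum_j <N_{e_j} v, J e_j> = 0] leaves
    [S^* - S = sum_ij <N_{e_j} e_i, N_{e_i} e_j>], and Cauchy-Schwarz concludes. *)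

(** * Pfaffian sums and their cofactors *)

(** Closedness is expressed on vectors that are constant in a chart, while the curvature sums use a
    frame orthonormal at every point; in general no frame is both. So the trace of [d omega] is
    computed at a point on constant vectors and then transported: [sum_ij P_ij T(v_i, v_j)] depends
    on the [v_i] only through a bivector, and [W P^T = f] identifies that bivector as a multiple of
    the inverse of [omega], which does not depend on the basis. Dividing by [f] needs a nonzero
    Pfaffian; constant vectors chosen as pairs [u, u J] at the point make it, up to a constant, a
    product of squared lengths, which avoids relating the squared Pfaffian to the determinant. The
    trace is needed on an open set because the curvature argument differentiates it. The frame need
    not be parallel at the point: its covariant derivatives form a skew matrix, and varying both
    slots of a trace by a skew matrix contributes nothing. *)

Section PairIndices.
Context (k : nat).

Lemma pair_fst_subproof (l : 'I_k) : (l.*2 < k.*2)%N.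
Proof. by rewrite ltn_double. Qed.

Lemma pair_snd_subproof (l : 'I_k) : (l.*2.+1 < k.*2)%N.
Proof. by rewrite -doubleS leq_double. Qed.

Definition pair_fst (l : 'I_k) : 'I_k.*2 := Ordinal (pair_fst_subproof l).
Definition pair_snd (l : 'I_k) : 'I_k.*2 := Ordinal (pair_snd_subproof l).

Lemma pair_fst_inj : injective pair_fst.
Proof. by move=> i j /(congr1 val) /= /double_inj /val_inj. Qed.

Lemma pair_snd_inj : injective pair_snd.
Proof. by move=> i j /(congr1 val) /= [] /double_inj /val_inj. Qed.

Lemma pair_fst_neq_snd (i j : 'I_k) : pair_fst i != pair_snd j.
Proof.
by apply/negP => /eqP /(congr1 (odd \o val)) /=; rewrite !odd_double.
Qed.

Variant pair_index_spec : 'I_k.*2 -> Type :=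
| PairFst l : pair_index_spec (pair_fst l)
| PairSnd l : pair_index_spec (pair_snd l).

Lemma pair_indexP q : pair_index_spec q.
Proof.
have q2 : (q./2 < k)%N by rewrite ltn_half_double.
have := odd_double_half q; case: (odd q) => /= e.
  suff -> : q = pair_snd (Ordinal q2) by constructor.
  by apply: val_inj; rewrite /= -[LHS]e.
suff -> : q = pair_fst (Ordinal q2) by constructor.
by apply: val_inj; rewrite /= -[LHS]e.
Qed.

(** Moving two entries at a time makes the permutation even, so any pair can be brought to position
    [ord0] of a signed sum without a sign. *)
Definition pair_swap (i j : 'I_k) : 'S_k.*2 :=
  (tperm (pair_fst i) (pair_fst j) * tperm (pair_snd i) (pair_snd j))%g.

Lemma pair_swap_fst i j l : pair_swap i j (pair_fst l) = pair_fst (tperm i j l).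
Proof.
rewrite permM; have -> : tperm (pair_fst i) (pair_fst j) (pair_fst l) =
    pair_fst (tperm i j l) by rewrite (inj_tperm _ _ _ pair_fst_inj).
by apply: tpermD; rewrite eq_sym pair_fst_neq_snd.
Qed.

Lemma pair_swap_snd i j l : pair_swap i j (pair_snd l) = pair_snd (tperm i j l).
Proof.
rewrite permM (_ : tperm (pair_fst i) _ _ = pair_snd l); last first.
  by apply: tpermD; rewrite pair_fst_neq_snd.
by rewrite (inj_tperm _ _ _ (@pair_snd_inj)).
Qed.

Lemma odd_pair_swap i j : odd_perm (pair_swap i j) = false.
Proof.
rewrite odd_permM !odd_tperm (inj_eq pair_fst_inj) (inj_eq pair_snd_inj).
by rewrite addbb.
Qed.

End PairIndices.

Lemma pair_fst_lift k (l : 'I_k) :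
  pair_fst (lift ord0 l) = lift ord0 (lift ord0 (pair_fst l)) :> 'I_k.*2.+2.
Proof. by apply: val_inj. Qed.

Lemma pair_snd_lift k (l : 'I_k) :
  pair_snd (lift ord0 l) = lift ord0 (lift ord0 (pair_snd l)) :> 'I_k.*2.+2.
Proof. by apply: val_inj. Qed.

Lemma pair_fst0 k : pair_fst (ord0 : 'I_k.+1) = ord0 :> 'I_k.*2.+2.
Proof. by apply: val_inj. Qed.

Lemma pair_snd0 k : pair_snd (ord0 : 'I_k.+1) = lift ord0 ord0 :> 'I_k.*2.+2.
Proof. by apply: val_inj. Qed.

(** A permutation with [s a = b] is determined by the bijection it induces between the complements
    of [a] and [b]. Applied twice, this removes the pair pinned in [pfcof]. *)
Lemma sum_lift_perm_fst (V : zmodType) n (a b : 'I_n.+1) (f : 'S_n.+1 -> V) :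
  \sum_(s : 'S_n.+1 | s a == b) f s = \sum_(s : 'S_n) f (lift_perm a b s).
Proof.
(* The default of [odflt] is never reached: [s (lift i k)] differs from [s i] by injectivity. *)
pose ulsf i (s : 'S_n.+1) k := odflt k (unlift (s i) (s (lift i k))).
have ulsfK i (s : 'S_n.+1) k : lift (s i) (ulsf i s k) = s (lift i k).
  rewrite /ulsf; have:= neq_lift i k.
  by rewrite -(can_eq (permK s)) => /unlift_some[] ? ? ->.
have inj_ulsf : injective (ulsf a _).
  move=> s; apply: can_inj (ulsf (s a) s^-1%g) _ => k'.
  by rewrite {1}/ulsf ulsfK !permK liftK.
rewrite (reindex (lift_perm a b)); last first.
  exists (fun s => perm (inj_ulsf s)) => [s _ | s].
    by apply/permP=> k'; rewrite permE /ulsf lift_perm_lift lift_perm_id liftK.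
  rewrite unfold_in => /eqP si0; apply/permP=> k.
  case: (unliftP a k) => [k'|] ->; rewrite ?lift_perm_id //.
  by rewrite lift_perm_lift -si0 permE ulsfK.
by apply: eq_bigl => s; rewrite lift_perm_id eqxx.
Qed.

Section PfaffianSum.
Context (R : comNzRingType).

Definition pair_prod k (W : 'I_k.*2 -> 'I_k.*2 -> R) (s : 'S_k.*2) : R :=
  \prod_l W (s (pair_fst l)) (s (pair_snd l)).

(* [2 ^ k * k`!] times the Pfaffian of [W]. *)
Definition pfsum k (W : 'I_k.*2 -> 'I_k.*2 -> R) : R :=
  \sum_(s : 'S_k.*2) (-1) ^+ s * pair_prod W s.

(** The coefficient of [W i j] at pair position [ord0]. All [k.+1] positions contribute alike, so
    the partial derivative of [pfsum], with the entries taken as independent, is [k.+1] times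
    this. *)
Definition pfcof k (W : 'I_k.+1.*2 -> 'I_k.+1.*2 -> R) (i j : 'I_k.+1.*2) : R :=
  \sum_(s : 'S_k.+1.*2 | (s (pair_fst ord0) == i) && (s (pair_snd ord0) == j))
     (-1) ^+ s * \prod_(l < k) W (s (pair_fst (lift ord0 l)))
                                 (s (pair_snd (lift ord0 l))).

Lemma eq_pfsum k (W W' : 'I_k.*2 -> 'I_k.*2 -> R) :
  (forall i j, W i j = W' i j) -> pfsum W = pfsum W'.
Proof.
by move=> e; apply: eq_bigr => s _; congr (_ * _); apply: eq_bigr => l _.
Qed.

(** Serves twice: with [h] the derivative of [W] it is the Leibniz rule for [pfsum], and with [h] a
    substituted row and column it is a Laplace expansion. The factor counts the positions [l], made
    equivalent by [pair_swap ord0 l]. *)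
Lemma pfsum_block k (W h : 'I_k.+1.*2 -> 'I_k.+1.*2 -> R) :
  \sum_(s : 'S_k.+1.*2) (-1) ^+ s *
    (\sum_l h (s (pair_fst l)) (s (pair_snd l)) *
       \prod_(l' | l' != l) W (s (pair_fst l')) (s (pair_snd l'))) =
  k.+1%:R * \sum_i \sum_j h i j * pfcof W i j.
Proof.
under eq_bigr do rewrite mulr_sumr.
rewrite exchange_big /=.
pose c := \sum_i \sum_j h i j * pfcof W i j.
rewrite (eq_bigr (fun=> c)) => [|l _].
  by rewrite sumr_const card_ord mulr_natl.
rewrite (reindex_inj (mulgI (pair_swap ord0 l))) /=.
rewrite {}/c pair_big_dep /=.
rewrite (partition_big (fun s : 'S_k.+1.*2 =>
   (s (pair_fst ord0), s (pair_snd ord0))) predT) //=.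
apply: eq_bigr => -[i j] _ /=; rewrite /pfcof mulr_sumr.
apply: eq_big => [s|s]; first by rewrite xpair_eqE.
rewrite xpair_eqE => /andP[/eqP si /eqP sj].
rewrite odd_permM odd_pair_swap /= !(permM (pair_swap _ _)) pair_swap_fst pair_swap_snd tpermR.
rewrite si sj mulrCA; congr (_ * (_ * _)).
rewrite (reindex_inj (@perm_inj _ (tperm ord0 l))) /=.
rewrite big_mkcond big_ord_recl /= tpermL eqxx /= mul1r.
apply: eq_bigr => l' _.
have -> : (tperm ord0 l (lift ord0 l') != l).
  by rewrite -{2}(tpermL ord0 l) (inj_eq perm_inj).
by rewrite !(permM (pair_swap _ _)) pair_swap_fst pair_swap_snd tpermK.
Qed.

Lemma pfcof_skew k (W : 'I_k.+1.*2 -> 'I_k.+1.*2 -> R) i j :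
  pfcof W j i = - pfcof W i j.
Proof.
rewrite /pfcof (reindex_inj (mulgI (tperm (pair_fst ord0) (pair_snd ord0)))) /=.
rewrite -sumrN; apply: eq_big => [s|s _].
  by rewrite !permM tpermL tpermR andbC.
rewrite odd_permM odd_tperm pair_fst_neq_snd signr_addb /= mulN1r mulNr.
congr (- (_ * _)); apply: eq_bigr => l _; rewrite !permM !tpermD //.
all: try exact: pair_fst_neq_snd; try by rewrite eq_sym pair_fst_neq_snd.
all: by rewrite ?(inj_eq (@pair_fst_inj _)) ?(inj_eq (@pair_snd_inj _)) neq_lift.
Qed.

Lemma pfcof_diag k (W : 'I_k.+1.*2 -> 'I_k.+1.*2 -> R) i : pfcof W i i = 0.
Proof.
rewrite /pfcof big_pred0 // => s.
apply/negP => /andP[/eqP <-]; rewrite (inj_eq perm_inj) eq_sym.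
exact/negP/pair_fst_neq_snd.
Qed.

(** The sign [(-1) ^+ i], for the position of the second index among those other than [a], is the
    one in [ext_d]: a row of cofactors matches the terms of an exterior derivative. *)
Lemma pfcof_lift k (W : 'I_k.+1.*2 -> 'I_k.+1.*2 -> R)
    (a : 'I_k.*2.+2) (i : 'I_k.*2.+1) :
  pfcof W a (lift a i) = (-1) ^+ a * ((-1) ^+ i *
    pfsum (fun p q : 'I_k.*2 => W (lift a (lift i p)) (lift a (lift i q)))).
Proof.
rewrite /pfcof pair_fst0 pair_snd0.
rewrite (eq_bigr (fun s : 'S_k.*2.+2 => (-1) ^+ odd_perm s *
  \prod_(l < k) W (s (lift ord0 (lift ord0 (pair_fst l))))
                 (s (lift ord0 (lift ord0 (pair_snd l)))))); last first.
  by move=> s _; congr (_ * _); apply: eq_bigr => l _;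
     rewrite pair_fst_lift pair_snd_lift.
rewrite big_mkcondr /= sum_lift_perm_fst.
rewrite -big_mkcond /=.
rewrite (eq_bigl (fun s : 'S_k.*2.+1 => s ord0 == i)); last first.
  by move=> s; rewrite lift_perm_lift (inj_eq lift_inj).
rewrite sum_lift_perm_fst /pfsum !mulr_sumr; apply: eq_bigr => s _.
rewrite !odd_lift_perm /= !signr_addb !signr_odd !mulrA.
by congr (_ * _); apply: eq_bigr => l _; rewrite !lift_perm_lift.
Qed.

(* For [a != b] the sum is, up to a factor, the Pfaffian of a form with two equal
   rows. *)
Lemma pfsum_expand k (W : 'I_k.+1.*2 -> 'I_k.+1.*2 -> R) :
  (forall i j, W j i = - W i j) -> forall a b,
  (k.+1.*2)%:R * (\sum_j W b j * pfcof W a j) = (a == b)%:R * pfsum W.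
Proof.
move=> Wskew a b.
pose f i := if i == a then b else i.
pose W' i j := W (f i) (f j).
(* Exactly one pair of [s] contains [a], and [h] vanishes on all the others, so the sum over [l] in
   [block] has a single nonzero term. *)
pose h i j := (i == a)%:R * W b j + (j == a)%:R * W i b.
have block s : pair_prod W' s = \sum_l h (s (pair_fst l)) (s (pair_snd l)) *
    \prod_(l' | l' != l) W (s (pair_fst l')) (s (pair_snd l')).
  have other l : s (pair_fst l) != a -> s (pair_snd l) != a ->
      h (s (pair_fst l)) (s (pair_snd l)) = 0.
    by move=> /negPf n1 /negPf n2; rewrite /h n1 n2 !mul0r addr0.
  have [q sq] : exists q, s q = a by exists (s^-1%g a); rewrite permKV.
  case: (pair_indexP q) sq => l sq.
  - have nf l' : l' != l -> s (pair_fst l') != a.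
      by rewrite -sq (inj_eq perm_inj) (inj_eq (@pair_fst_inj _)).
    have ns l' : s (pair_snd l') != a.
      by rewrite -sq (inj_eq perm_inj) eq_sym pair_fst_neq_snd.
    rewrite (bigD1 l) //= [X in _ + X]big1 ?addr0 => [|l' l'l]; last first.
      by rewrite other ?mul0r ?nf.
    rewrite /pair_prod (bigD1 l) //=; congr (_ * _); last first.
      by apply: eq_bigr => l' l'l; rewrite /W' /f (negPf (nf _ _)) // (negPf (ns _)).
    by rewrite /W' /f /h sq eqxx (negPf (ns _)) mul1r mul0r addr0.
  - have nf l' : l' != l -> s (pair_snd l') != a.
      by rewrite -sq (inj_eq perm_inj) (inj_eq (@pair_snd_inj _)).
    have ns l' : s (pair_fst l') != a.
      by rewrite -sq (inj_eq perm_inj) pair_fst_neq_snd.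
    rewrite (bigD1 l) //= [X in _ + X]big1 ?addr0 => [|l' l'l]; last first.
      by rewrite other ?mul0r ?nf.
    rewrite /pair_prod (bigD1 l) //=; congr (_ * _); last first.
      by apply: eq_bigr => l' l'l; rewrite /W' /f (negPf (nf _ _)) // (negPf (ns _)).
    by rewrite /W' /f /h sq eqxx (negPf (ns _)) mul1r mul0r add0r.
have e1 : pfsum W' = k.+1%:R * \sum_i \sum_j h i j * pfcof W i j.
  by rewrite -pfsum_block; apply: eq_bigr => s _; rewrite block.
(* The two halves of [h] contribute equally because [W] and the cofactors are both skew; this turns
   [k.+1] into [k.+1.*2]. *)
have e2 : \sum_i \sum_j h i j * pfcof W i j = (\sum_j W b j * pfcof W a j) *+ 2.
  rewrite mulr2n {1}/h.
  transitivity (\sum_i \sum_j ((i == a)%:R * (W b j * pfcof W i j)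
       + (j == a)%:R * (W b i * pfcof W a i))).
    apply: eq_bigr => i _; apply: eq_bigr => j _; rewrite mulrDl -!mulrA.
    congr (_ + _); have [->|] := eqVneq j a; last by rewrite !mul0r.
    by rewrite pfcof_skew Wskew mulrNN.
  under eq_bigr do rewrite big_split /=.
  rewrite big_split /=; congr (_ + _).
    rewrite (bigD1 a) //= [X in _ + X]big1 ?addr0; last first.
      by move=> i /negPf ia; apply: big1 => j _; rewrite ia mul0r.
    by apply: eq_bigr => j _; rewrite eqxx mul1r.
  apply: eq_bigr => i _; rewrite (bigD1 a) //= eqxx mul1r big1 ?addr0 //.
  by move=> j /negPf ->; rewrite mul0r.
have -> : (k.+1.*2)%:R = 2%:R * k.+1%:R :> R by rewrite -natrM mul2n.
rewrite -mulrA mulrCA [2%:R * _]mulr_natl -e2 -e1.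
have [eab|nab] := eqVneq a b.
  rewrite mul1r; apply: eq_pfsum => i j.
  by rewrite /W' /f -eab; do 2?case: eqP => [->|_].
rewrite mul0r.
have W't i j : W' (tperm a b i) (tperm a b j) = W' i j.
  have ft i' : f (tperm a b i') = f i'.
    rewrite /f; case: tpermP => [->|->|/eqP/negPf -> _ //].
      by rewrite eq_sym (negPf nab) eqxx.
    by rewrite eq_sym (negPf nab) eqxx.
  by rewrite /W' !ft.
(* in characteristic 2 [x = - x] says nothing, so even permutations are paired
   with odd ones explicitly *)
rewrite /pfsum (bigID (fun s : 'S_k.+1.*2 => odd_perm s)) /=.
rewrite (reindex_inj (mulIg (tperm a b))) /=.
apply/eqP; rewrite addr_eq0 -sumrN; apply/eqP; apply: eq_big => [s|s os].
  by rewrite odd_permM odd_tperm nab addbT.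
have -> : pair_prod W' (s * tperm a b)%g = pair_prod W' s.
  by apply: eq_bigr => l _; rewrite !permM W't.
by rewrite odd_permM odd_tperm nab signr_addb mulrN1 mulNr.
Qed.

Lemma pfsum0 (W : 'I_0.*2 -> 'I_0.*2 -> R) : pfsum W = 1.
Proof.
rewrite /pfsum (bigD1 (1%g : 'S_0.*2)) //= big1 ?addr0 => [|s].
  by rewrite odd_perm1 expr0 mul1r /pair_prod big_ord0.
by case/eqP; apply/permP => -[].
Qed.

(** An inner permutation, extended by two fixed points, has the same sign and can be absorbed into
    the outer one; so each of the inner ones yields a whole [pfsum]. This is the recursion of the
    wedge power. *)
Lemma pfsum_shuffle k (W : 'I_k.*2.+2 -> 'I_k.*2.+2 -> R) :
  \sum_(s : 'S_k.*2.+2) (-1) ^+ s * W (s ord0) (s (lift ord0 ord0)) *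
    pfsum (fun i j => W (s (lift ord0 (lift ord0 i)))
                        (s (lift ord0 (lift ord0 j)))) =
  (k.*2)`!%:R * pfsum (W : 'I_k.+1.*2 -> 'I_k.+1.*2 -> R).
Proof.
under eq_bigr do rewrite /pfsum mulr_sumr.
rewrite exchange_big /= (eq_bigr (fun=> pfsum (k := k.+1) W)) => [|r _].
  by rewrite sumr_const card_Sn mulr_natl.
rewrite /pfsum.
pose r2 : 'S_k.*2.+2 := lift_perm ord0 ord0 (lift_perm ord0 ord0 r).
rewrite [RHS](reindex_inj (mulgI (r2 : 'S_k.+1.*2))) /=.
apply: eq_bigr => s _.
rewrite odd_permM signr_addb {1}/r2 !odd_lift_perm /= /pair_prod.
rewrite big_ord_recl !permM pair_fst0 pair_snd0.
rewrite {1 2}/r2 lift_perm_lift !lift_perm_id.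
rewrite -!mulrA [RHS]mulrCA; congr (_ * _).
rewrite [LHS]mulrCA; congr (_ * (_ * _)).
apply: eq_bigr => l _; rewrite !permM pair_fst_lift pair_snd_lift /r2.
by rewrite !lift_perm_lift.
Qed.

End PfaffianSum.

(** * Calculus of matrix-valued maps *)

Section MatrixCalculus.
Context (R : realType) (V : normedModType R).

(** The first-order expansion of [f] at [x] is also one of [g], and uniqueness of the differential
    makes it the differential of [g]. It lets a function be replaced by a formula valid only
    nearby. *)
Lemma differentiable_near (W : normedModType R) (f g : V -> W) x :
  (\forall y \near x, f y = g y) -> differentiable f x -> differentiable g x.
Proof.
move=> fg df; have fgx : f x = g x := nbhs_singleton fg.
have dg : g \o shift x = cst (g x) + 'd f x +o_ 0 id.
  apply/eqaddoP => e e0; have /eqaddoP/(_ _ e0) := diff_locally df.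
  have fg0 : \forall h \near (0 : V), f (h + x) = g (h + x).
    by move: fg; rewrite (near_shift 0) /= subr0.
  rewrite -fgx; apply: filterS2 fg0 => h /= fgh.
  by rewrite /= -[(_ - _) h]/(f (h + x) - (f x + 'd f x h)) fgh.
have e := diff_unique (diff_continuous df) dg.
by apply/diff_locallyP; rewrite e; split => //; exact: diff_continuous.
Qed.

Lemma differentiable_addf (W : normedModType R) (f g : V -> W) x :
  differentiable f x -> differentiable g x ->
  differentiable (fun y => f y + g y) x.
Proof. by move=> df dg; exact: (differentiableD df dg). Qed.

Lemma derive_addf (W : normedModType R) (f g : V -> W) x v :
  differentiable f x -> differentiable g x ->
  'D_v (fun y => f y + g y) x = 'D_v f x + 'D_v g x.
Proof.
by move=> df dg; rewrite -deriveD //; exact: diff_derivable.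
Qed.

Lemma differentiable_sumf (W : normedModType R) (I : Type) (r : seq I)
    (P : pred I) (f : I -> V -> W) x :
  (forall i, P i -> differentiable (f i) x) ->
  differentiable (fun y => \sum_(i <- r | P i) f i y) x.
Proof.
move=> df; elim: r => [|i r IH].
  under eq_fun => y do rewrite big_nil.
  exact: differentiable_cst.
under eq_fun => y do rewrite big_cons.
by case Pi: (P i) => //; apply: differentiable_addf => //; exact: df.
Qed.

Lemma derive_sumf (W : normedModType R) (I : Type) (r : seq I)
    (P : pred I) (f : I -> V -> W) x v :
  (forall i, P i -> differentiable (f i) x) ->
  'D_v (fun y => \sum_(i <- r | P i) f i y) x =
  \sum_(i <- r | P i) 'D_v (f i) x.
Proof.
move=> df; elim: r => [|i r IH].
  under eq_fun => y do rewrite big_nil.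
  by rewrite big_nil (derive_cst 0).
under eq_fun => y do rewrite big_cons.
rewrite big_cons; case Pi: (P i) => //; rewrite derive_addf ?IH //.
  exact: df.
exact: differentiable_sumf.
Qed.

Lemma differentiable_mxP m n (f : V -> 'M[R]_(m, n)) x :
  differentiable f x <-> forall i j, differentiable (fun y => f y i j : R) x.
Proof.
split=> [df i j|df].
  exact: (differentiable_comp df (differentiable_coord _ i j)).
have -> : f = fun y => \sum_i \sum_j f y i j *: delta_mx i j.
  by apply/funext => y; rewrite -matrix_sum_delta.
by do 2!apply: differentiable_sumf => ? _; apply: differentiableZl.
Qed.

Lemma derive_coord m n (f : V -> 'M[R]_(m, n)) x v i j :
  differentiable f x -> ('D_v f x) i j = 'D_v (fun y => f y i j : R) x.
Proof. by move=> df; rewrite derive_mx ?mxE//; exact: diff_derivable. Qed.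

Lemma differentiable_mulf (f g : V -> R) x :
  differentiable f x -> differentiable g x ->
  differentiable (fun y => f y * g y : R) x.
Proof. by move=> df dg; exact: (differentiableM df dg). Qed.

Lemma derive_mulf (f g : V -> R) x v :
  differentiable f x -> differentiable g x ->
  'D_v (fun y => f y * g y : R) x = 'D_v f x * g x + f x * 'D_v g x.
Proof.
move=> df dg.
rewrite (deriveM (diff_derivable df) (diff_derivable dg)) addrC.
by rewrite [X in X + _ = _]mulrC.
Qed.

Lemma differentiable_mulcf (c : R) (f : V -> R) x :
  differentiable f x -> differentiable (fun y => c * f y : R) x.
Proof. by move=> df; apply: differentiable_mulf => //; exact: differentiable_cst. Qed.

Lemma derive_mulcf (c : R) (f : V -> R) x v :
  differentiable f x -> 'D_v (fun y => c * f y : R) x = c * 'D_v f x.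
Proof.
by move=> df; rewrite derive_mulf // (derive_cst (c : R)) mul0r add0r.
Qed.

Lemma differentiable_mulmx m n p (A : V -> 'M[R]_(m, n)) (B : V -> 'M[R]_(n, p)) x :
  differentiable A x -> differentiable B x ->
  differentiable (fun y => A y *m B y) x.
Proof.
move=> /differentiable_mxP dA /differentiable_mxP dB.
apply/differentiable_mxP => i j.
under eq_fun do rewrite mxE.
by apply: differentiable_sumf => k _; exact: differentiable_mulf.
Qed.

Lemma derive_mulmx m n p (A : V -> 'M[R]_(m, n)) (B : V -> 'M[R]_(n, p)) x v :
  differentiable A x -> differentiable B x ->
  'D_v (fun y => A y *m B y) x = 'D_v A x *m B x + A x *m 'D_v B x.
Proof.
move=> dA dB; apply/matrixP => i j.
rewrite derive_coord; last exact: differentiable_mulmx.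
move: (dA) (dB) => /differentiable_mxP dA' /differentiable_mxP dB'.
under eq_fun do rewrite mxE.
rewrite derive_sumf => [|k _]; last exact: differentiable_mulf.
rewrite !mxE -big_split /=; apply: eq_bigr => k _.
by rewrite derive_mulf // -!derive_coord.
Qed.

Lemma differentiable_trmx m n (A : V -> 'M[R]_(m, n)) x :
  differentiable A x -> differentiable (fun y => (A y)^T) x.
Proof.
move=> /differentiable_mxP dA; apply/differentiable_mxP => i j.
by under eq_fun do rewrite mxE.
Qed.

Lemma derive_trmx m n (A : V -> 'M[R]_(m, n)) x v :
  differentiable A x -> 'D_v (fun y => (A y)^T) x = ('D_v A x)^T.
Proof.
move=> dA; apply/matrixP => i j.
rewrite mxE !derive_coord //; last exact: differentiable_trmx.
by under eq_fun do rewrite mxE.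
Qed.

Lemma differentiable_prodf n (f : 'I_n -> V -> R) x :
  (forall i, differentiable (f i) x) ->
  differentiable (fun y => \prod_i f i y) x.
Proof.
elim: n f => [|n IH] f df.
  under eq_fun do rewrite big_ord0.
  exact: differentiable_cst.
under eq_fun do rewrite big_ord_recl.
by apply: differentiable_mulf => //; exact: IH.
Qed.

Lemma derive_prodf n (f : 'I_n -> V -> R) x v :
  (forall i, differentiable (f i) x) ->
  'D_v (fun y => \prod_i f i y) x =
  \sum_i 'D_v (f i) x * \prod_(j | j != i) f j x.
Proof.
elim: n f => [|n IH] f df.
  under eq_fun do rewrite big_ord0.
  by rewrite big_ord0 (derive_cst (1 : R)).
under eq_fun do rewrite big_ord_recl.
rewrite derive_mulf //; last exact: differentiable_prodf.
rewrite big_ord_recl IH //; congr (_ * _ + _).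
  by rewrite [RHS]big_mkcond big_ord_recl /= mul1r.
rewrite mulr_sumr; apply: eq_bigr => i _.
rewrite mulrCA; congr (_ * _).
rewrite [RHS]big_mkcond big_ord_recl /= -big_mkcond /=.
by congr (_ * _); apply: eq_bigl => j; rewrite (inj_eq lift_inj).
Qed.

Lemma derive_diff_sum (W : normedModType R) (I : Type) (r : seq I) (f : V -> W)
    x (c : I -> R) (u : I -> V) : differentiable f x ->
  'D_(\sum_(i <- r) c i *: u i) f x = \sum_(i <- r) c i *: 'D_(u i) f x.
Proof.
move=> df; rewrite deriveE // linear_sum; apply: eq_bigr => i _.
by rewrite linearZ -deriveE.
Qed.

Lemma derive_dirP (W : normedModType R) (f : V -> W) x a u v :
  differentiable f x ->
  'D_(a *: u + v) f x = a *: 'D_u f x + 'D_v f x.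
Proof. by move=> df; rewrite !deriveE // linearP. Qed.

Lemma differentiable_det n (A : V -> 'M[R]_n) x :
  differentiable A x -> differentiable (fun y => \det (A y) : R) x.
Proof.
move=> /differentiable_mxP dA; apply: differentiable_sumf => s _.
apply: differentiable_mulf; first exact: differentiable_cst.
exact: differentiable_prodf.
Qed.

Lemma differentiable_invmx n (A : V -> 'M[R]_n) x :
  differentiable A x -> (\forall y \near x, A y \in unitmx) ->
  differentiable (fun y => invmx (A y)) x.
Proof.
move=> dA uA.
(* [invmx] returns a singular matrix unchanged, so Cramer's formula is available only near [x]. *)
apply: (@differentiable_near _ (fun y => (\det (A y))^-1 *: \adj (A y))).
  by apply: filterS uA => y uy; rewrite /invmx uy.
have ux := nbhs_singleton uA.
apply/differentiable_mxP => i j.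
under eq_fun do rewrite !mxE.
apply: differentiable_mulf.
  apply: differentiableV; first exact: differentiable_det.
  by move: ux; rewrite unitmxE unitfE.
apply: differentiable_mulf; first exact: differentiable_cst.
apply: differentiable_det; apply/differentiable_mxP => i' j'.
under eq_fun do rewrite !mxE.
by move/differentiable_mxP: dA.
Qed.

End MatrixCalculus.

(** * Divergence of the cofactors *)

(** Row [pair_fst ord0] is nonzero only at its partner, so expanding along it leaves one entry times
    the sum for the remaining pairs. *)
Lemma pfsum_adapted_neq0 (R : numFieldType) k (W : 'I_k.*2 -> 'I_k.*2 -> R) :
  (forall i j, W j i = - W i j) ->
  (forall l q, q != pair_snd l -> W (pair_fst l) q = 0) ->
  (forall l, W (pair_fst l) (pair_snd l) != 0) -> pfsum W != 0.
Proof.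
elim: k W => [|k IH] W Wskew Wad Wn0.
  by rewrite pfsum0 oner_neq0.
have := pfsum_expand Wskew (pair_fst ord0) (pair_fst ord0).
rewrite eqxx mul1r => <-; rewrite mulf_neq0 ?pnatr_eq0 //.
rewrite (bigD1 (pair_snd ord0)) //= [X in _ + X]big1 ?addr0 => [|j j0]; last first.
  by rewrite Wad // mul0r.
rewrite mulf_neq0 // pair_fst0 pair_snd0.
rewrite (pfcof_lift W ord0 ord0) !expr0 !mul1r; apply: IH => [i j|l q qn|l].
- exact: Wskew.
- have := Wad (lift ord0 l) (lift ord0 (lift ord0 q)).
  rewrite pair_fst_lift pair_snd_lift; apply.
  by rewrite !(inj_eq lift_inj).
- by have := Wn0 (lift ord0 l); rewrite pair_fst_lift pair_snd_lift.
Qed.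

(* [P] is the matrix of Pfaffian cofactors of [W], [f] is proportional to the
   Pfaffian, and [dW c], [dP c], [df c] are derivatives along the [c]-th vector: differentiating [W *m P^T = f%:M]
   turns the divergence condition on [P] into a contraction of [dW]. *)
Lemma cofactor_divergence (R : numFieldType) n (W P : 'M[R]_n)
    (dW dP : 'I_n -> 'M[R]_n) (f : R) (df : 'I_n -> R) :
  f != 0 -> P^T = - P -> W *m P^T = f%:M ->
  (forall c, dW c *m P^T + W *m (dP c)^T = (df c)%:M) ->
  (forall c, df c = 2^-1 * \sum_i \sum_j dW c i j * P i j) ->
  (forall a, \sum_c dP c a c = 0) ->
  forall e, \sum_i \sum_j P i j * (dW i j e + 2^-1 * dW e i j) = 0.
Proof.
move=> f0 Pskew WP dWP dfE dP0.
have PW : P^T *m W = f%:M.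
  have : W *m (f^-1 *: P^T) = 1%:M by rewrite -scalemxAr WP scale_scalar_mx mulVf.
  move=> /mulmx1C; rewrite -scalemxAl => e.
  by rewrite -[LHS]scale1r -(mulfV f0) -scalerA e scale_scalar_mx mulr1.
(* Multiply the differentiated identity by [P^T] on the left and contract its row index with the
   direction [c]: the term in [dP] becomes [f] times a divergence and vanishes, and the rest says
   that [X] and [Y] agree after [P^T]. *)
pose X : 'rV[R]_n := \row_j \sum_b \sum_c P b c * dW c b j.
pose Y : 'rV[R]_n := \row_c df c.
have XY : X *m P^T = Y *m P^T.
  apply/rowP => a.
  have : \sum_c ((P^T *m dW c *m P^T) c a + f * dP c a c) = \sum_c df c * P a c.
    apply: eq_bigr => c _.
    have := congr1 (fun Z => (P^T *m Z) c a) (dWP c).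
    rewrite mulmxDr !mulmxA PW mul_scalar_mx mul_mx_scalar !mxE => <-.
    by congr (_ + _); rewrite mxE.
  rewrite big_split /= -mulr_sumr dP0 mulr0 addr0 => e.
  transitivity (\sum_c (P^T *m dW c *m P^T) c a).
    rewrite mxE.
    under [RHS]eq_bigr do rewrite mxE.
    rewrite [RHS]exchange_big /=; apply: eq_bigr => j _.
    rewrite -mulr_suml; congr (_ * _); rewrite mxE exchange_big /=.
    apply: eq_bigr => c _; rewrite mxE; apply: eq_bigr => b _.
    by rewrite mxE.
  rewrite e mxE; apply: eq_bigr => c _; by rewrite !mxE.
have {}XY : X = Y.
  have := congr1 (mulmx^~ W) XY; rewrite -!mulmxA PW !mul_mx_scalar.
  exact: scalerI.
move=> e; have := congr1 (fun Z : 'rV_n => Z 0 e) XY; rewrite !mxE dfE => eXY.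
under eq_bigr do (under eq_bigr do rewrite mulrDr; rewrite big_split /=).
rewrite big_split /= addrC; apply/eqP; rewrite addr_eq0; apply/eqP.
transitivity (2^-1 * \sum_i \sum_j dW e i j * P i j).
  rewrite mulr_sumr; apply: eq_bigr => i _.
  rewrite mulr_sumr; apply: eq_bigr => j _; ring.
rewrite -eXY exchange_big /= -sumrN; apply: eq_bigr => i _.
rewrite -sumrN; apply: eq_bigr => j _.
have := congr1 (fun Z : 'M[R]_n => Z i j) Pskew; rewrite !mxE => ->.
by rewrite mulNr.
Qed.

Lemma differentiable_pfsum (R : realType) (V : normedModType R) k
    (W : V -> 'I_k.*2 -> 'I_k.*2 -> R) x :
  (forall i j, differentiable (fun y => W y i j : R) x) ->
  differentiable (fun y => pfsum (W y) : R) x.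
Proof.
move=> dW; apply: differentiable_sumf => s _; apply: differentiable_mulcf.
exact: differentiable_prodf.
Qed.

Section PfaffianCalculus.
Context (R : realType) (V : normedModType R) (k : nat).
Context (W : V -> 'I_k.+1.*2 -> 'I_k.+1.*2 -> R) (x : V).
Hypothesis dW : forall i j, differentiable (fun y => W y i j : R) x.

Lemma differentiable_pfcof i j :
  differentiable (fun y => pfcof (W y) i j : R) x.
Proof.
apply: differentiable_sumf => s _; apply: differentiable_mulcf.
exact: differentiable_prodf.
Qed.

Lemma derive_pfsum v : 'D_v (fun y => pfsum (W y) : R) x =
  k.+1%:R * \sum_i \sum_j 'D_v (fun y => W y i j : R) x * pfcof (W x) i j.
Proof.
rewrite -pfsum_block derive_sumf => [|s _]; last first.
  by apply: differentiable_mulcf; exact: differentiable_prodf.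
apply: eq_bigr => s _; rewrite derive_mulcf; last exact: differentiable_prodf.
by congr (_ * _); exact: derive_prodf.
Qed.

(** Skewness is assumed near [x] because the expansion [W *m P^T = f%:M] has to be differentiated;
    the Pfaffian is inverted only at [x]. *)
Lemma pfcof_divergence (v : 'I_k.+1.*2 -> V) :
  (\forall y \near x, forall i j, W y j i = - W y i j) ->
  pfsum (W x) != 0 ->
  (forall a, \sum_j 'D_(v j) (fun y => pfcof (W y) a j : R) x = 0) ->
  forall e, \sum_i \sum_j pfcof (W x) i j *
    ('D_(v i) (fun y => W y j e : R) x + 2^-1 * 'D_(v e) (fun y => W y i j : R) x)
    = 0.
Proof.
move=> Wskew F0 divP.
pose n2 : R := (k.+1.*2)%:R.
have n20 : n2 != 0 by rewrite pnatr_eq0.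
have expand y : (forall i j, W y j i = - W y i j) -> forall a b,
    \sum_j W y b j * pfcof (W y) a j = (a == b)%:R * (n2^-1 * pfsum (W y)).
  move=> sk a b; have := pfsum_expand sk a b; rewrite -/n2 => e.
  by rewrite mulrCA -e mulKf.
pose P y := \matrix_(i, j) pfcof (W y) i j.
pose Wm y := \matrix_(i, j) W y i j.
have Wx := nbhs_singleton Wskew.
pose dF c := n2^-1 * 'D_(v c) (fun y => pfsum (W y) : R) x.
have dpf := differentiable_pfsum dW.
have H := @cofactor_divergence R _ (Wm x) (P x)
  (fun c => \matrix_(i, j) 'D_(v c) (fun y => W y i j : R) x)
  (fun c => \matrix_(i, j) 'D_(v c) (fun y => pfcof (W y) i j : R) x)
  (n2^-1 * pfsum (W x)) dF.
move=> e.
have {}H : \sum_i \sum_j (P x) i j *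
  ((\matrix_(i0, j0) 'D_(v i) (fun y => W y i0 j0 : R) x) j e
   + 2^-1 * (\matrix_(i0, j0) 'D_(v e) (fun y => W y i0 j0 : R) x) i j) = 0.
  apply: H.
  - by rewrite mulf_neq0 // invr_neq0.
  - by apply/matrixP => i j; rewrite !mxE pfcof_skew.
  - apply/matrixP => b a; rewrite !mxE -mulr_natl eq_sym -expand //.
    by apply: eq_bigr => j _; rewrite !mxE.
  - move=> c; apply/matrixP => b a; rewrite !mxE -big_split /=.
    transitivity ('D_(v c) (fun y => \sum_j W y b j * pfcof (W y) a j : R) x).
      rewrite derive_sumf => [|j _]; last first.
        by apply: differentiable_mulf => //; exact: differentiable_pfcof.
      apply: eq_bigr => j _; rewrite !mxE derive_mulf //.
      exact: differentiable_pfcof.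
    rewrite (@near_eq_derive _ _ _ _
      (fun y => (b == a)%:R * n2^-1 * pfsum (W y) : R)); last first.
      apply: filterS Wskew => y sk /=; by rewrite expand // eq_sym mulrA.
    by rewrite derive_mulcf // -mulrA mulr_natl.
  (* The [k.+1] of the Leibniz rule against [n2 = k.+1.*2] produces the [2^-1]. *)
  - move=> c; rewrite /dF derive_pfsum mulrA; congr (_ * _).
      rewrite /n2 -muln2 natrM invfM mulrAC mulVf ?mul1r // pnatr_eq0 //.
    by apply: eq_bigr => i _; apply: eq_bigr => j _; rewrite !mxE.
  - by move=> a; rewrite -[RHS](divP a); apply: eq_bigr => c _; rewrite mxE.
by rewrite -[RHS]H; apply: eq_bigr => i _; apply: eq_bigr => j _; rewrite !mxE.
Qed.

End PfaffianCalculus.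

(** * Hermitian linear algebra *)

Section Inner.
Context (R : realType) (n : nat).
Implicit Types (G J : 'M[R]_n) (u v w : 'rV[R]_n).

Lemma innerE G u v : inner G u v = \sum_i \sum_j u 0 i * G i j * v 0 j.
Proof.
rewrite /inner mxE exchange_big /=; apply: eq_bigr => j _.
by rewrite !mxE mulr_suml.
Qed.

Lemma inner_delta G i j : inner G (delta_mx 0 i) (delta_mx 0 j) = G i j.
Proof.
rewrite /inner -rowE trmx_delta mxE (bigD1 j) //= big1 ?addr0.
  by rewrite !mxE !eqxx mulr1.
by move=> k /negPf kj; rewrite !mxE kj mulr0.
Qed.

Lemma innerDl G u v w : inner G (u + v) w = inner G u w + inner G v w.
Proof. by rewrite /inner !mulmxDl mxE. Qed.

Lemma innerDr G u v w : inner G w (u + v) = inner G w u + inner G w v.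
Proof. by rewrite /inner linearD /= mulmxDr mxE. Qed.

Lemma innerZl G a u w : inner G (a *: u) w = a * inner G u w.
Proof. by rewrite /inner -!scalemxAl mxE. Qed.

Lemma innerZr G a u w : inner G w (a *: u) = a * inner G w u.
Proof. by rewrite /inner linearZ /= -scalemxAr mxE. Qed.

Lemma innerNl G u w : inner G (- u) w = - inner G u w.
Proof. by rewrite -scaleN1r innerZl mulN1r. Qed.

Lemma innerNr G u w : inner G w (- u) = - inner G w u.
Proof. by rewrite -scaleN1r innerZr mulN1r. Qed.

Lemma innerBl G u v w : inner G (u - v) w = inner G u w - inner G v w.
Proof. by rewrite innerDl innerNl. Qed.

Lemma inner0l G w : inner G 0 w = 0.
Proof. by rewrite -(scale0r 0) innerZl mul0r. Qed.

Lemma inner0r G w : inner G w 0 = 0.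
Proof. by rewrite -(scale0r 0) innerZr mul0r. Qed.

Lemma inner_suml G (I : Type) (r : seq I) (P : pred I) (f : I -> 'rV[R]_n) w :
  inner G (\sum_(i <- r | P i) f i) w = \sum_(i <- r | P i) inner G (f i) w.
Proof. by rewrite /inner !mulmx_suml summxE. Qed.

Lemma inner_sumr G (I : Type) (r : seq I) (P : pred I) (f : I -> 'rV[R]_n) w :
  inner G w (\sum_(i <- r | P i) f i) = \sum_(i <- r | P i) inner G w (f i).
Proof. by rewrite /inner raddf_sum /= mulmx_sumr summxE. Qed.

Lemma innerDG G H u v : inner (G + H) u v = inner G u v + inner H u v.
Proof. by rewrite /inner mulmxDr mulmxDl mxE. Qed.

Lemma innerZG a G u v : inner (a *: G) u v = a * inner G u v.
Proof. by rewrite /inner -scalemxAr -scalemxAl mxE. Qed.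

Lemma inner_tr G u v : inner G^T u v = inner G v u.
Proof.
rewrite /inner; have -> : u *m G^T *m v^T = (v *m G *m u^T)^T.
  by rewrite !trmx_mul !trmxK mulmxA.
by rewrite mxE.
Qed.

Definition bilin (T : 'rV[R]_n -> 'rV[R]_n -> R) : Prop :=
  (forall a u v w, T (a *: u + v) w = a * T u w + T v w) /\
  (forall a u v w, T w (a *: u + v) = a * T w u + T w v).

Lemma bilin_sum T (I J : finType) (c : I -> R) (d : J -> R)
    (u : I -> 'rV[R]_n) (v : J -> 'rV[R]_n) : bilin T ->
  T (\sum_i c i *: u i) (\sum_j d j *: v j) =
  \sum_i \sum_j c i * d j * T (u i) (v j).
Proof.
move=> [Tl Tr].
have T0l w : T 0 w = 0.
  by have := Tl (-1) 0 0 w; rewrite scaler0 addr0 mulN1r addNr.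
have T0r w : T w 0 = 0.
  by have := Tr (-1) 0 0 w; rewrite scaler0 addr0 mulN1r addNr.
transitivity (\sum_i c i * T (u i) (\sum_j d j *: v j)).
  by elim/big_rec2: _ => // i y1 y2 _ <-.
apply: eq_bigr => i _.
transitivity (c i * \sum_j d j * T (u i) (v j)).
  by congr (_ * _); elim/big_rec2: _ => // j y1 y2 _ <-.
by rewrite mulr_sumr; apply: eq_bigr => j _; rewrite mulrA.
Qed.

Lemma bilin_mxE T : bilin T ->
  forall u v, T u v = inner (\matrix_(i, j) T (delta_mx 0 i) (delta_mx 0 j)) u v.
Proof.
move=> bT u v; rewrite {1}(row_sum_delta u) {1}(row_sum_delta v) bilin_sum // innerE.
by apply: eq_bigr => i _; apply: eq_bigr => j _; rewrite mxE mulrAC.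
Qed.

(** The trace form isolates all dependence on [P] and [A] in one matrix, which is what allows a
    change of basis. *)
Lemma contraction_trace p (P : 'M[R]_p) (A : 'M[R]_(p, n)) T : bilin T ->
  \sum_i \sum_j P i j * T (row i A) (row j A) =
  \tr (A^T *m P^T *m A *m
       \matrix_(i, j) T (delta_mx 0 i) (delta_mx 0 j)).
Proof.
move=> bT; set M := (\matrix_(_, _) _).
have TE i j : T (row i A) (row j A) = (A *m M *m A^T) i j.
  by rewrite (bilin_mxE bT) -/M /inner -row_mul tr_row !mxE;
     apply: eq_bigr => l _; rewrite !mxE.
transitivity (\tr (P^T *m (A *m M *m A^T))).
  rewrite exchange_big; apply: eq_bigr => j _; rewrite mxE.
  by apply: eq_bigr => i _; rewrite TE [P^T _ _]mxE.
by rewrite !mulmxA mxtrace_mulC !mulmxA.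
Qed.

(* [A^T *m P *m A] is the bivector [\sum_ij P i j a_i (x) a_j]. *)
Lemma contraction_change p q (P : 'M[R]_p) (A : 'M[R]_(p, n))
    (Q : 'M[R]_q) (B : 'M[R]_(q, n)) T : bilin T ->
  A^T *m P *m A = B^T *m Q *m B ->
  \sum_i \sum_j P i j * T (row i A) (row j A) =
  \sum_i \sum_j Q i j * T (row i B) (row j B).
Proof.
move=> bT /(congr1 trmx); rewrite !trmx_mul !trmxK !mulmxA => e.
by rewrite !contraction_trace // e.
Qed.

End Inner.

Record hermitian_pair (R : realType) (n : nat) (G J : 'M[R]_n) : Prop :=
  HermitianPair {
  herm_sym : forall u v, inner G u v = inner G v u;
  herm_pos : forall u, u != 0 -> 0 < inner G u u;
  herm_sq : forall u : 'rV[R]_n, u *m J *m J = - u;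
  herm_acs : forall u v, inner G (u *m J) (v *m J) = inner G u v
}.

Section HermitianPair.
Context (R : realType) (n : nat) (G J : 'M[R]_n).
Hypothesis GJ : hermitian_pair G J.
Implicit Types (u v w : 'rV[R]_n).

Local Notation "<< u , v >>" := (inner G u v).

Lemma herm_skew u v : << u *m J, v >> = - << u, v *m J >>.
Proof.
by rewrite -(herm_acs GJ u) (herm_sq GJ) innerNr opprK.
Qed.

Lemma herm_nondeg u : (forall w, << u, w >> = 0) -> u = 0.
Proof.
by move=> u0; apply/eqP; apply: contraT => /(herm_pos GJ); rewrite u0 ltxx.
Qed.

Lemma herm_unit : G \in unitmx.
Proof.
rewrite -row_free_unit -kermx_eq0; apply/rowV0P => u /sub_kermxP uG.
by apply: herm_nondeg => w; rewrite /inner uG mul0mx mxE.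
Qed.

Lemma herm_ge0 u : 0 <= << u, u >>.
Proof.
by have [->|/(herm_pos GJ)/ltW //] := eqVneq u 0; rewrite inner0l.
Qed.

Lemma herm_trG : G^T = G.
Proof.
by apply/matrixP => i j; rewrite mxE -!inner_delta (herm_sym GJ).
Qed.

Lemma herm_JJ : J *m J = - 1%:M.
Proof.
by apply/row_matrixP => i; rewrite rowE mulmxA (herm_sq GJ) rowE mulmxN mulmx1.
Qed.

Lemma herm_JGJ : J *m G *m J^T = G.
Proof.
apply/matrixP => i j; rewrite -!inner_delta -[RHS](herm_acs GJ).
by rewrite /inner trmx_mul !mulmxA.
Qed.

Section Frame.
Context (e : 'I_n -> 'rV[R]_n).
Hypothesis e_on : forall i j, << e i, e j >> = (i == j)%:R.

Let E : 'M[R]_n := \matrix_i e i.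

Lemma frame_gram : E *m G *m E^T = 1%:M.
Proof.
apply/matrixP => i j; rewrite [RHS]mxE -e_on /inner.
rewrite -(rowK e i) -(rowK e j) -/E -row_mul tr_row.
by rewrite -row_mul !mxE; apply: eq_bigr => l _; rewrite !mxE.
Qed.

(** Hence a trace over an orthonormal frame is a contraction with the inverse metric, whatever the
    frame. *)
Lemma frame_cogram : E^T *m E = invmx G.
Proof.
have h : E^T *m (E *m G) = 1%:M by apply: mulmx1C; exact: frame_gram.
by rewrite -[LHS]mulmx1 -(mulmxV herm_unit) mulmxA -[_ *m E *m G]mulmxA h mul1mx.
Qed.

Lemma frame_expand u : u = \sum_i << u, e i >> *: e i.
Proof.
have h : E^T *m (E *m G) = 1%:M by apply: mulmx1C; exact: frame_gram.
have := congr1 trmx h; rewrite !trmx_mul trmxK trmx1 herm_trG => h'.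
rewrite -[LHS]mulmx1 -h' mulmxA mulmx_sum_row; apply: eq_bigr => i _.
rewrite rowK; congr (_ *: _).
by rewrite /inner mulmxA [LHS]mxE [RHS]mxE; apply: eq_bigr => l _; rewrite !mxE.
Qed.

(** The vectors [e i *m J] form another orthonormal frame: [J] preserves the inverse metric. *)
Lemma frame_trace_acs T : bilin T ->
  \sum_i T (e i *m J) (e i *m J) = \sum_i T (e i) (e i).
Proof.
move=> bT.
have tr1 (A : 'M[R]_n) (a : 'I_n -> 'rV[R]_n) : (forall i, a i = row i A) ->
    \sum_i T (a i) (a i) =
    \sum_i \sum_j (1%:M : 'M[R]_n) i j * T (row i A) (row j A).
  move=> aE; apply: eq_bigr => i _; rewrite (bigD1 i) //= mxE eqxx mul1r aE.
  by rewrite big1 ?addr0 // => j /negPf ji; rewrite mxE eq_sym ji mul0r.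
rewrite (tr1 (E *m J)); last by move=> i; rewrite row_mul rowK.
rewrite (tr1 E); last by move=> i; rewrite rowK.
apply: contraction_change => //.
rewrite !mulmx1 trmx_mul mulmxA -(mulmxA J^T) frame_cogram.
have uG := herm_unit.
apply: (can_inj (mulKmx uG)); rewrite mulmxV //.
have JG : J *m G = - (G *m J^T).
  have /(congr1 trmx) := herm_JJ; rewrite trmx_mul linearN /= trmx1 => tJ.
  by rewrite -[in RHS]herm_JGJ -!mulmxA tJ !mulmxN mulmx1 opprK.
rewrite mulmxA mulmxA -[G *m J^T]opprK -JG mulNmx mulmxK // mulNmx herm_JJ.
by rewrite opprK.
Qed.

End Frame.

End HermitianPair.

(** Passing to the frame [e i *m J] turns [T(e, e J)] into [T(e J, - e)], so by symmetry the trace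
    is its own negative. *)
Lemma frame_trace_skew (R : realType) n (G J : 'M[R]_n) (e : 'I_n -> 'rV[R]_n) T :
  hermitian_pair G J -> (forall i j, inner G (e i) (e j) = (i == j)%:R) ->
  bilin T -> (forall u v, T u v = T v u) -> \sum_i T (e i) (e i *m J) = 0.
Proof.
move=> GJ eon bT Tsym.
have bT' : bilin (fun u v => T u (v *m J)).
  case: bT => Tl Tr; split=> a u v w; first exact: Tl.
  by rewrite mulmxDl -scalemxAl Tr.
have := frame_trace_acs GJ eon bT'; rewrite /= => E.
have : \sum_i T (e i) (e i *m J) = - \sum_i T (e i) (e i *m J).
  rewrite -{1}E -sumrN; apply: eq_bigr => i _.
  rewrite (herm_sq GJ) -scaleN1r -[_ *: e i]addr0 (proj2 bT) Tsym.
  have -> : T (e i *m J) 0 = 0.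
    by have := proj2 bT (-1) 0 0 (e i *m J); rewrite scaler0 addr0 mulN1r addNr.
  by rewrite addr0 mulN1r.
by lra.
Qed.

(** * Bases adapted to the complex structure *)

Section AdaptedBasis.
Context (R : realType) (m : nat) (G J : 'M[R]_(m.*2)).
Hypothesis GJ : hermitian_pair G J.

(** Gram-Schmidt by counting: orthogonality to the [k] previous vectors and to their images under
    [J] is [k.*2] linear conditions in dimension [m.*2], so a nonzero solution remains while
    [k < m]. *)
Lemma adapted_family k : (k <= m)%N -> exists u : 'I_k -> 'rV[R]_(m.*2),
  (forall i, u i != 0) /\ (forall i j, i != j ->
     inner G (u i) (u j) = 0 /\ inner G (u i) (u j *m J) = 0).
Proof.
elim: k => [|k IH] km; first by exists (fun=> 0); split=> -[].
have [u [u0 uo]] := IH (ltnW km).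
pose U : 'M[R]_(k, m.*2) := \matrix_i u i.
pose A := G *m (col_mx U (U *m J))^T.
have kA : kermx A != 0.
  rewrite kermx_eq0 /row_free neq_ltn; apply/orP; left.
  apply: leq_ltn_trans (rank_leq_col _) _.
  by rewrite addnn ltn_double.
have /rowV0Pn[w /sub_kermxP wA w0] := kA.
have wAE i : inner G w (u i) = 0 /\ inner G w (u i *m J) = 0.
  move: wA; rewrite /A tr_col_mx mul_mx_row mul_mx_row => wA.
  have := congr1 lsubmx wA; have := congr1 rsubmx wA.
  rewrite row_mxKl row_mxKr linear0 linear0 => eJ eU; split.
    have := congr1 (fun Z : 'rV[R]_k => Z 0 i) eU; rewrite mulmxA [RHS]mxE => <-.
    rewrite /inner [LHS]mxE [RHS]mxE.
    by apply: eq_bigr => l _; rewrite !mxE.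
  have := congr1 (fun Z : 'rV[R]_k => Z 0 i) eJ; rewrite mulmxA [RHS]mxE => <-.
  rewrite /inner [LHS]mxE [RHS]mxE.
  apply: eq_bigr => l _; rewrite !mxE; congr (_ * _).
  by apply: eq_bigr => p _; rewrite !mxE.
exists (fun i => oapp u w (unlift ord0 i)); split=> [i|i j].
  by case: unliftP => [i' _|_] /=; [exact: u0|exact: w0].
case: unliftP => [i'|] ->; case: unliftP => [j'|] -> //=.
- by rewrite (inj_eq lift_inj); exact: uo.
- move=> _; have [h1 h2] := wAE i'; rewrite (herm_sym GJ) h1; split=> //.
  by apply/eqP; rewrite (herm_sym GJ) (herm_skew GJ) h2 oppr0.
Qed.

(** Pairing [u l] with [u l *m J] gives the form the single entry [- |u l|^2] on each pair. Linear
    independence is not recorded; [balanced_trace] recovers it from the nonzero Pfaffian. *)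
Lemma adapted_basis : exists v : 'I_m.*2 -> 'rV[R]_(m.*2),
  pfsum (fun i j => inner G (v i) (v j *m J)) != 0.
Proof.
have [u [u0 uo]] := adapted_family (leqnn m).
pose v (q : 'I_m.*2) : 'rV[R]_(m.*2) :=
  match pair_indexP q with PairFst l => u l | PairSnd l => u l *m J end.
have vf l : v (pair_fst l) = u l.
  rewrite /v; move: (erefl (pair_fst l)); move: {1 3}(pair_fst l) => q.
  case: (pair_indexP q) => l'; first by move/pair_fst_inj ->.
  by move/esym/eqP; rewrite (negPf (pair_fst_neq_snd _ _)).
have vs l : v (pair_snd l) = u l *m J.
  rewrite /v; move: (erefl (pair_snd l)); move: {1 3}(pair_snd l) => q.
  case: (pair_indexP q) => l'; last by move/pair_snd_inj ->.
  by move/eqP; rewrite (negPf (pair_fst_neq_snd _ _)).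
have uu l : inner G (u l) (u l *m J) = 0.
  have := herm_skew GJ (u l) (u l); rewrite (herm_sym GJ); lra.
exists v; apply: pfsum_adapted_neq0 => [i j|l q|l].
- by rewrite (herm_sym GJ) (herm_skew GJ).
- case: (pair_indexP q) => l'; rewrite vf ?vf ?vs => ql.
    by have [->|/uo[]] := eqVneq l l'.
  rewrite (herm_sq GJ) innerNr (proj1 (uo _ _ _)) ?oppr0 //.
  by apply: contra ql => /eqP ->.
- by rewrite vf vs (herm_sq GJ) innerNr oppr_eq0 gt_eqF // (herm_pos GJ).
Qed.

End AdaptedBasis.

(** * Powers of the fundamental form *)

Section WedgePower.
Context (R : realType) (n : nat) (G J : 'rV[R]_n -> 'M[R]_n).

Definition kform (y u v : 'rV[R]_n) : R := inner (G y) u (v *m J y).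

(** The
    [(k.*2)]![of]pfsum_shuffle[cancels the one in]wedge[, and each further factor]omega[leaves]2[!^-1]. *)
Lemma wedge_powE k x (v : 'I_k.*2 -> 'rV[R]_n) :
  wedge_pow (fundamental_form G J) k x v =
  2 ^- k * pfsum (fun i j => kform x (v i) (v j)).
Proof.
elim: k v => [|k IH] v; first by rewrite /= pfsum0 expr0 invr1 mulr1.
rewrite [LHS]/= /wedge.
under eq_bigr do rewrite IH.
pose W (i j : 'I_k.*2.+2) := kform x (v i) (v j).
transitivity ((2`! * (k.*2)`!)%N%:R^-1 * (2 ^- k *
   ((k.*2)`!%:R * pfsum (W : 'I_k.+1.*2 -> 'I_k.+1.*2 -> R)))).
  congr (_ * _); rewrite -pfsum_shuffle mulr_sumr.
  apply: eq_bigr => s _; rewrite mulrCA; congr (_ * (_ * _ * _)).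
    rewrite /fundamental_form /W /kform.
    by congr (inner _ (v (s _)) (v (s _) *m _)); apply: val_inj.
  apply: eq_pfsum => i j; rewrite /W.
  by congr (kform _ (v (s _)) (v (s _))); apply: val_inj.
rewrite natrM exprS (_ : 2`! = 2)%N // -/W.
have : (k.*2)`!%:R != 0 :> R by rewrite pnatr_eq0 -lt0n fact_gt0.
have : 2 ^+ k != 0 :> R by rewrite expf_neq0 // pnatr_eq0.
move: (_ ^+ k) (_`!%:R) (pfsum _) => t c F t0 c0.
by field; rewrite c0 t0.
Qed.

End WedgePower.

Section KformCalculus.
Context (R : realType) (n : nat) (G J : 'rV[R]_n -> 'M[R]_n) (x : 'rV[R]_n).
Hypotheses (dG : differentiable G x) (dJ : differentiable J x).

(** A coordinate derivative on constant [v] and [w], hence not a tensor; [dkformE] separates its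
    covariant part. *)
Definition dkform (u v w : 'rV[R]_n) : R :=
  'D_u (fun y => kform G J y v w) x.

Lemma differentiable_kform v w : differentiable (fun y => kform G J y v w : R) x.
Proof.
have d : differentiable (fun y => v *m G y *m (w *m J y)^T) x.
  apply: differentiable_mulmx.
    by apply: differentiable_mulmx => //; exact: differentiable_cst.
  apply: differentiable_trmx.
  by apply: differentiable_mulmx => //; exact: differentiable_cst.
by move/differentiable_mxP : d; apply.
Qed.

Lemma dkform_lin_dir a u u' v w :
  dkform (a *: u + u') v w = a * dkform u v w + dkform u' v w.
Proof. by rewrite /dkform derive_dirP //; exact: differentiable_kform. Qed.

Lemma dkform_linl a u v v' w :
  dkform u (a *: v + v') w = a * dkform u v w + dkform u v' w.
Proof.
rewrite /dkform /kform.
under eq_fun do rewrite innerDl innerZl.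
rewrite derive_addf ?derive_mulcf //; do ?apply: differentiable_mulcf;
  exact: differentiable_kform.
Qed.

Lemma dkform_linr a u v w w' :
  dkform u v (a *: w + w') = a * dkform u v w + dkform u v w'.
Proof.
rewrite /dkform /kform.
under eq_fun do rewrite mulmxDl -scalemxAl innerDr innerZr.
rewrite derive_addf ?derive_mulcf //; do ?apply: differentiable_mulcf;
  exact: differentiable_kform.
Qed.

End KformCalculus.

(** * Closedness of the power as a trace condition *)

Section BalancedTrace.
Context (R : realType) (k : nat).
Let n := k.+1.*2.
Context (G J : 'rV[R]_n -> 'M[R]_n) (x : 'rV[R]_n).
Hypothesis GJ : \forall y \near x, hermitian_pair (G y) (J y).
Hypotheses (dG : differentiable G x) (dJ : differentiable J x).
Hypothesis dw0 : forall v,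
  ext_d (wedge_pow (fundamental_form G J) k) x v = 0.

(** Evaluate [d (omega ^ k)] on all the [b i] except [b a]: the term differentiated along [b j]
    leaves out [b a] and [b j], hence is a cofactor up to sign and scale. The term [j = a] is
    zero. *)
Lemma cofactor_closed (b : 'I_n -> 'rV[R]_n) a :
  \sum_j 'D_(b j) (fun y =>
      pfcof (fun i j : 'I_n => kform G J y (b i) (b j)) a j : R) x = 0.
Proof.
rewrite (@bigD1_ord _ _ _ k.*2.+2 (a : 'I_k.*2.+2)) //=.
under eq_fun do rewrite pfcof_diag.
rewrite (derive_cst (0 : R)) add0r.
have := dw0 (fun i : 'I_k.*2.+1 => b (lift (a : 'I_k.*2.+2) i)).
rewrite /ext_d => e.
(* The prefactor restores the sign of [pfcof_lift] and undoes the [2 ^- k] of [wedge_powE]. *)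
transitivity ((-1) ^+ a * 2 ^+ k * (\sum_(i < k.*2.+1)  (-1) ^+ i *
  ('D_(b (lift (a : 'I_k.*2.+2) i)) (fun y => wedge_pow (fundamental_form G J) k y
     (fun j => b (lift (a : 'I_k.*2.+2) (lift i j))) : R^o) x))); last first.
  by rewrite e mulr0.
rewrite mulr_sumr; apply: eq_bigr => i _.
under eq_fun do rewrite pfcof_lift.
have dpf : differentiable (fun y => pfsum (fun p q : 'I_k.*2 =>
   kform G J y (b (lift (a : 'I_k.*2.+2) (lift i p)))
     (b (lift (a : 'I_k.*2.+2) (lift i q)))) : R) x.
  by apply: differentiable_pfsum => p q; exact: differentiable_kform.
rewrite derive_mulcf; last exact: differentiable_mulcf.
rewrite derive_mulcf //.
have -> : (fun y => wedge_pow (fundamental_form G J) k y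
     (fun j => b (lift (a : 'I_k.*2.+2) (lift i j))) : R^o) =
  fun y => 2 ^- k * pfsum (fun p q : 'I_k.*2 =>
   kform G J y (b (lift (a : 'I_k.*2.+2) (lift i p)))
     (b (lift (a : 'I_k.*2.+2) (lift i q)))) : R.
  by apply/funext => y; rewrite wedge_powE.
rewrite derive_mulcf //.
rewrite -!mulrA; congr (_ * _).
rewrite [RHS]mulrCA; congr (_ * _).
by rewrite mulVKf // expf_neq0 // pnatr_eq0.
Qed.

(** By invariance of frame traces under [J], the sum is half of [sum_i (d omega)(e_i, e_i J, w)]. *)
Lemma balanced_trace (e : 'I_n -> 'rV[R]_n) :
  (forall i j, inner (G x) (e i) (e j) = (i == j)%:R) -> forall w,
  \sum_i (dkform G J x (e i) (e i *m J x) w + 2^-1 * dkform G J x w (e i) (e i *m J x)) = 0.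
Proof.
move=> eon.
have GJx := nbhs_singleton GJ.
have [v Fn0] := adapted_basis GJx.
pose W y (i j : 'I_n) := kform G J y (v i) (v j).
have Wskew : \forall y \near x, forall i j, W y j i = - W y i j.
  apply: filterS GJ => y GJy i j.
  by rewrite /W /kform (herm_sym GJy) (herm_skew GJy).
have dW i j : differentiable (fun y => W y i j : R) x.
  exact: differentiable_kform.
pose T w u u' := dkform G J x u u' w + 2^-1 * dkform G J x w u u'.
have bT w : bilin (T w).
  by split=> a u u' z; rewrite /T ?(dkform_lin_dir, dkform_linl, dkform_linr) //; ring.
have Tlin a u u' z z' : T (a *: z + z') u u' = a * T z u u' + T z' u u'.
  by rewrite /T ?(dkform_lin_dir, dkform_linl, dkform_linr) //; ring.
have H := pfcof_divergence dW Wskew Fn0 (cofactor_closed v).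
pose P : 'M[R]_n := \matrix_(i, j) pfcof (W x) i j.
have [f fE] : exists f : R, f = n%:R^-1 * pfsum (W x) by eexists.
have f0 : f != 0 by rewrite fE mulf_neq0 // invr_neq0 // pnatr_eq0.
pose A : 'M[R]_n := \matrix_i v i.
pose E : 'M[R]_n := \matrix_i e i.
(* [B] is the matrix of [omega] at [x], so [W x] is [A *m B *m A^T]; the cofactor expansion then
   also shows that [A] is invertible. *)
have [B BE] : exists B, B = G x *m (J x)^T by eexists.
have WP : A *m B *m A^T *m P^T = f%:M.
  apply/matrixP => b a; rewrite [LHS]mxE [RHS]mxE.
  have n0 : (k.+1.*2)%:R != 0 :> R by rewrite pnatr_eq0.
  have := pfsum_expand (nbhs_singleton Wskew) a b => /(canRL (mulKf n0)).
  rewrite mulrCA -/n -fE mulr_natl eq_sym => <-; apply: eq_bigr => j _.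
  rewrite [P^T _ _]mxE [P _ _]mxE; congr (_ * _).
  rewrite /W /kform /inner -(rowK v b) -(rowK v j) -/A.
  have -> : row b A *m G x *m (row j A *m J x)^T = row b (A *m B) *m (row j A)^T.
    by rewrite trmx_mul row_mul BE !mulmxA.
  by rewrite [LHS]mxE [RHS]mxE; apply: eq_bigr => l _; rewrite !mxE.
have AB1 : A *m (f^-1 *: (B *m A^T *m P^T)) = 1%:M.
  by rewrite -scalemxAr !mulmxA WP scale_scalar_mx mulVf.
have [AU _] := mulmx1_unit AB1.
have BX : B *m (A^T *m P^T *m A) = f%:M.
  have := mulmx1C AB1; rewrite -scalemxAl => h.
  by rewrite !mulmxA -[LHS]scale1r -(mulfV f0) -scalerA h scale_scalar_mx mulr1.
have uG := herm_unit GJx.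
have JtJt : (J x)^T *m (J x)^T = - 1%:M.
  by rewrite -trmx_mul (herm_JJ GJx) linearN /= trmx1.
(* The bivector is [f] times the inverse of [B], so it depends on [v] only through the scalar
   [f]. *)
have XE : A^T *m P^T *m A = - f *: ((J x)^T *m invmx (G x)).
  have h : - ((J x)^T *m invmx (G x)) *m B = 1%:M.
    by rewrite BE mulNmx mulmxA mulmxKV // JtJt opprK.
  by rewrite -[LHS]mul1mx -h -(mulmxA _ B) BX mul_mx_scalar scalerN scaleNr.
(* The same bivector in the orthonormal frame: up to [- f], these are the components of
   [e i *m J x]. *)
pose Q : 'M[R]_n := \matrix_(i, j) (- f * inner (G x) (e i *m J x) (e j)).
have QE : Q = - f *: (E *m J x *m G x *m E^T).
  apply/matrixP => i j; rewrite [LHS]mxE [RHS]mxE; congr (_ * _).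
  rewrite /inner -(rowK e i) -(rowK e j) -/E -!row_mul.
  by rewrite mxE [LHS]mxE [RHS]mxE; apply: eq_bigr => l _; rewrite !mxE.
have EE := frame_cogram GJx eon; rewrite -/E in EE.
have change w : \sum_i \sum_j P i j * T w (v i) (v j) =
    - f * \sum_i T w (e i) (e i *m J x).
  have -> : \sum_i \sum_j P i j * T w (v i) (v j) =
      \sum_i \sum_j P i j * T w (row i A) (row j A).
    by apply: eq_bigr => i _; apply: eq_bigr => j _; rewrite !rowK.
  rewrite (@contraction_change _ _ _ _ P A Q E) //; last first.
    apply: trmx_inj; rewrite !trmx_mul !trmxK !mulmxA XE QE.
    rewrite [(_ *: _)^T]linearZ /= !trmx_mul trmxK -scalemxAr -scalemxAl; congr (_ *: _).
    rewrite !mulmxA EE (herm_trG GJx) mulVmx // mul1mx.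
    by rewrite -mulmxA EE.
  rewrite mulr_sumr; apply: eq_bigr => i _.
  rewrite [in RHS](frame_expand GJx eon (e i *m J x)).
  have := bilin_sum (fun=> 1) (fun j => inner (G x) (e i *m J x) (e j))
    (fun _ : 'I_1 => e i) e (bT w).
  rewrite !big_ord1 scale1r => ->; rewrite mulr_sumr.
  by apply: eq_bigr => j _; rewrite !rowK mxE mul1r mulrA.
have Lv c : \sum_i T (v c) (e i) (e i *m J x) = 0.
  have := change (v c); rewrite (_ : \sum_i _ = 0).
    by move=> /esym/eqP; rewrite mulf_eq0 oppr_eq0 (negPf f0) => /eqP.
  by rewrite -[RHS](H c); apply: eq_bigr => i _; apply: eq_bigr => j _; rewrite mxE.
(* So far [w] is one of the [v c]; they span because [A] is invertible, and [T] is linear in [w]. *)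
move=> w; rewrite -/(T w _ _) -(mulmxKV AU w).
move: (w *m invmx A) => c; rewrite mulmx_sum_row.
rewrite (_ : \sum_i _ = \sum_i T (\sum_j c 0 j *: row j A) (e i) (e i *m J x)) //.
have T0 u u' : T 0 u u' = 0.
  by have := Tlin (-1) u u' 0 0; rewrite scaler0 addr0 mulN1r addNr.
have TS u u' : T (\sum_j c 0 j *: row j A) u u' = \sum_j c 0 j * T (v j) u u'.
  by elim/big_rec2: _ => // j y1 y2 _ <-; rewrite Tlin rowK.
under eq_bigr do rewrite TS.
by rewrite exchange_big big1 // => j _; rewrite -mulr_sumr Lv mulr0.
Qed.

End BalancedTrace.

(** * The tensor (nabla J) at a point *)

(* Derivatives are locked because the unifier diverges when it compares two of
   them up to conversion. *)
HB.lock Definition dmetric (R : realType) (n : nat) (G : 'rV[R]_n -> 'M[R]_n)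
    (x u v w : 'rV[R]_n) : R := inner ('D_u G x) v w.

HB.lock Definition gam (R : realType) (n : nat) (G : 'rV[R]_n -> 'M[R]_n)
    (x u v : 'rV[R]_n) : 'rV[R]_n := christoffel G x u v.

HB.lock Definition nabJ (R : realType) (n : nat) (G J : 'rV[R]_n -> 'M[R]_n)
    (x u v : 'rV[R]_n) : 'rV[R]_n :=
  v *m 'D_u J x + gam G x u (v *m J x) - gam G x u v *m J x.

Section InnerCalculus.
Context (R : realType) (V : normedModType R) (n : nat).
Context (G : V -> 'M[R]_n) (X Y : V -> 'rV[R]_n) (x : V).
Hypotheses (dG : differentiable G x) (dX : differentiable X x)
  (dY : differentiable Y x).

Lemma differentiable_inner : differentiable (fun y => inner (G y) (X y) (Y y) : R) x.
Proof.
have d : differentiable (fun y => X y *m G y *m (Y y)^T) x.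
  apply: differentiable_mulmx; first exact: differentiable_mulmx.
  exact: differentiable_trmx.
by move/differentiable_mxP : d; apply.
Qed.

Lemma derive_inner u : 'D_u (fun y => inner (G y) (X y) (Y y) : R) x =
  inner ('D_u G x) (X x) (Y x) + inner (G x) ('D_u X x) (Y x)
  + inner (G x) (X x) ('D_u Y x).
Proof.
have d1 : differentiable (fun y => X y *m G y) x by exact: differentiable_mulmx.
have d2 : differentiable (fun y => (Y y)^T) x by exact: differentiable_trmx.
rewrite /inner -derive_coord; last exact: differentiable_mulmx.
rewrite derive_mulmx // derive_mulmx // derive_trmx // mulmxDl !mxE.
by rewrite [X in X + _]addrC.
Qed.

End InnerCalculus.

Section PointwiseGeometry.
Context (R : realType) (n : nat) (G J : 'rV[R]_n -> 'M[R]_n) (x : 'rV[R]_n).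
Hypothesis GJ : \forall y \near x, hermitian_pair (G y) (J y).
Hypotheses (dG : differentiable G x) (dJ : differentiable J x).
Implicit Types (u v w : 'rV[R]_n).

Let GJx : hermitian_pair (G x) (J x) := nbhs_singleton GJ.
Local Notation "<< u , v >>" := (inner (G x) u v).
Local Notation DG := (dmetric G x).
Local Notation Gam := (gam G x).
Local Notation N := (nabJ G J x).

Lemma inner_inj u v : (forall w, << u, w >> = << v, w >>) -> u = v.
Proof.
move=> uv; apply/eqP; rewrite -subr_eq0; apply/eqP/(herm_nondeg GJx) => w.
by rewrite innerBl uv subrr.
Qed.

Lemma dmetric_sym u v w : DG u v w = DG u w v.
Proof.
have tr : ('D_u G x)^T = 'D_u G x.
  rewrite -derive_trmx //; apply: near_eq_derive.
  by apply: filterS GJ => y /herm_trG.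
by rewrite dmetric.unlock -{1}tr inner_tr.
Qed.

Lemma dmetric_dir a u u' v w : DG (a *: u + u') v w = a * DG u v w + DG u' v w.
Proof. by rewrite dmetric.unlock derive_dirP // innerDG innerZG. Qed.

Lemma dmetric_linr a u v w w' : DG u v (a *: w + w') = a * DG u v w + DG u v w'.
Proof. by rewrite dmetric.unlock innerDr innerZr. Qed.

Lemma dmetric_linl a u v v' w : DG u (a *: v + v') w = a * DG u v w + DG u v' w.
Proof. by rewrite dmetric.unlock innerDl innerZl. Qed.

(* Koszul formula *)
Lemma inner_gam u v w :
  << Gam u v, w >> = 2^-1 * (DG u v w + DG v u w - DG w u v).
Proof.
rewrite gam.unlock /christoffel /inner mulmxKV ?(herm_unit GJx) // mxE.
pose F w := 2^-1 * (DG u v w + DG v u w - DG w u v).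
have Flin a z z' : F (a *: z + z') = a * F z + F z'.
  by rewrite /F dmetric_dir !dmetric_linr; ring.
have F0 : F 0 = 0 by have := Flin (-1) 0 0; rewrite scaler0 addr0 mulN1r addNr.
transitivity (F w) => //; rewrite [in RHS](row_sum_delta w).
transitivity (\sum_l w 0 l * F (delta_mx 0 l)).
  apply: eq_bigr => l _; rewrite mulrC [_^T _ _]mxE [X in _ * X]mxE.
  by rewrite /F dmetric.unlock.
by elim/big_rec2: _ => // l y1 y2 _ ->; rewrite Flin.
Qed.

Lemma gam_sym u v : Gam u v = Gam v u.
Proof.
by apply: inner_inj => w; rewrite !inner_gam (dmetric_sym w u v); ring.
Qed.

Lemma gam_linr a u v w : Gam u (a *: v + w) = a *: Gam u v + Gam u w.
Proof.
apply: inner_inj => z; rewrite innerDl innerZl !inner_gam.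
by rewrite dmetric_dir dmetric_linl dmetric_linr; ring.
Qed.

Lemma gam_linl a u v w : Gam (a *: v + w) u = a *: Gam v u + Gam w u.
Proof. by rewrite gam_sym gam_linr !(gam_sym u). Qed.

Lemma gam0r u : Gam u 0 = 0.
Proof.
by have := gam_linr (-1) u 0 0; rewrite scaler0 addr0 scaleN1r addNr.
Qed.

Lemma gamN u v : Gam u (- v) = - Gam u v.
Proof.
by have := gam_linr (-1) u v 0; rewrite addr0 gam0r addr0 !scaleN1r.
Qed.

Lemma gamD u v w : Gam u (v + w) = Gam u v + Gam u w.
Proof. by have := gam_linr 1 u v w; rewrite !scale1r. Qed.

Lemma metric_parallel u v w : DG u v w = << Gam u v, w >> + << v, Gam u w >>.
Proof.
rewrite (herm_sym GJx v) !inner_gam.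
rewrite (dmetric_sym u w v).
by field.
Qed.

Lemma nabJ_linr a u v w : N u (a *: v + w) = a *: N u v + N u w.
Proof.
rewrite nabJ.unlock mulmxDl -scalemxAl mulmxDl -scalemxAl !gam_linr.
rewrite mulmxDl -scalemxAl !scalerDr !scalerN opprD.
by rewrite [X in X + _ = _]addrACA [LHS]addrACA.
Qed.

Lemma nabJ_linl a u v w : N (a *: v + w) u = a *: N v u + N w u.
Proof.
rewrite nabJ.unlock derive_dirP // mulmxDr -scalemxAr !gam_linl.
rewrite mulmxDl -scalemxAl !scalerDr !scalerN opprD.
by rewrite [X in X + _ = _]addrACA [LHS]addrACA.
Qed.

Lemma nabJ_anticomm u v : N u (v *m J x) = - (N u v *m J x).
Proof.
have : 'D_u (fun y => J y *m J y) x = 0.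
  rewrite (@near_eq_derive _ _ _ _ (cst (- 1%:M))) ?derive_cst //.
  by apply: filterS GJ => y /herm_JJ.
rewrite derive_mulmx // => /eqP; rewrite addrC addr_eq0 => /eqP DJ.
rewrite nabJ.unlock -mulmxA DJ (herm_sq GJx) gamN mulmxBl mulmxDl.
by rewrite (herm_sq GJx) mulmxN mulmxA opprK !opprD addrAC.
Qed.

(** Since the metric is parallel, the covariant derivative of [omega] is [<v, N_u w>]; the other two
    terms correct for [v] and [w] being constant rather than parallel. *)
Lemma dkformE u v w : dkform G J x u v w =
  << v, N u w >> + << Gam u v, w *m J x >> + << v, Gam u w *m J x >>.
Proof.
have dwJ : differentiable (fun y => w *m J y) x.
  by apply: differentiable_mulmx => //; exact: differentiable_cst.
rewrite /dkform /kform (derive_inner dG (differentiable_cst v x) dwJ).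
rewrite (derive_cst v) inner0l addr0.
rewrite (derive_mulmx _ (differentiable_cst w x) dJ) (derive_cst w) mul0mx add0r.
have := metric_parallel u v (w *m J x); rewrite {1}dmetric.unlock => ->.
by rewrite nabJ.unlock !innerDr innerNr; ring.
Qed.

Lemma nabJ_skew u v w : << N u v, w >> = - << v, N u w >>.
Proof.
have : dkform G J x u v w = - dkform G J x u w v.
  rewrite /dkform -mulN1r -derive_mulcf; last exact: differentiable_kform.
  apply: near_eq_derive; apply: filterS GJ => y GJy.
  by rewrite /kform (herm_sym GJy) (herm_skew GJy) mulN1r.
have a1 : << Gam u v, w *m J x >> = - << w, Gam u v *m J x >>.
  by rewrite (herm_sym GJx w) (herm_skew GJx) opprK.
have a2 : << v, Gam u w *m J x >> = - << Gam u w, v *m J x >>.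
  by rewrite (herm_sym GJx) (herm_skew GJx).
by rewrite !dkformE a1 a2 (herm_sym GJx w (N u v)); lra.
Qed.

Section Frame.
Context (e : 'I_n -> 'rV[R]_n).
Hypothesis eon : forall i j, << e i, e j >> = (i == j)%:R.

(** The Christoffel terms drop out: [Gam (e i) (e i *m J x)] has zero trace by symmetry, and the two
    traces of [Gam w] cancel by invariance under [J]. The trace of [N w] against [J] vanishes since
    [N w] is skew and anticommutes with [J]. *)
Lemma codifferential_trace w :
  \sum_i (dkform G J x (e i) (e i *m J x) w
          + 2^-1 * dkform G J x w (e i) (e i *m J x)) =
  << (\sum_i N (e i) (e i)) *m J x, w >>.
Proof.
have lin1 z : bilin (fun u v => << Gam u v, z >>).
  by split=> a u v t; rewrite ?gam_linl ?gam_linr innerDl innerZl.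
have lin2 z : bilin (fun u v => << u, Gam z v >>).
  by split=> a u v t; rewrite ?gam_linr ?innerDl ?innerDr ?innerZl ?innerZr.
have s1 : \sum_i << Gam (e i) (e i *m J x), w *m J x >> = 0.
  by apply: (frame_trace_skew GJx eon (lin1 (w *m J x))) => u v; rewrite gam_sym.
have s2 := frame_trace_acs GJx eon (lin2 w).
have N0 i : << e i, N w (e i *m J x) >> = 0.
  have : << e i, N w (e i *m J x) >> = - << e i, N w (e i *m J x) >>.
    rewrite {1}nabJ_anticomm innerNr (herm_sym GJx) (herm_skew GJx) opprK.
    by rewrite nabJ_skew.
  by lra.
transitivity (\sum_i << N (e i) (e i) *m J x, w >>
   + \sum_i << Gam (e i) (e i *m J x), w *m J x >>
   + 2^-1 * (\sum_i << e i, Gam w (e i) >>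
             - \sum_i << e i *m J x, Gam w (e i *m J x) >>)); last first.
  by rewrite s1 s2 subrr mulr0 !addr0 mulmx_suml inner_suml.
rewrite -big_split -sumrB mulr_sumr -big_split /=; apply: eq_bigr => i _.
rewrite !dkformE N0 (herm_sq GJx) innerNr (herm_acs GJx) (gam_sym (e i) w).
have -> : << e i *m J x, N (e i) w >> = << N (e i) (e i) *m J x, w >>.
  by rewrite -[LHS]opprK -nabJ_skew nabJ_anticomm innerNl opprK.
rewrite (herm_sym GJx (Gam w (e i))).
have -> : << e i, Gam w (e i *m J x) *m J x >> =
   - << e i *m J x, Gam w (e i *m J x) >> by rewrite (herm_skew GJx) opprK.
by field.
Qed.

Lemma codifferential_eq0 : (forall w,
  \sum_i (dkform G J x (e i) (e i *m J x) w
          + 2^-1 * dkform G J x w (e i) (e i *m J x)) = 0) ->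
  \sum_i N (e i) (e i) = 0.
Proof.
move=> tr0; apply/eqP; rewrite -oppr_eq0 -(herm_sq GJx).
rewrite (herm_nondeg GJx (u := (\sum_i N (e i) (e i)) *m J x)) ?mul0mx // => w.
by rewrite -codifferential_trace.
Qed.

Lemma codifferential_tensor v : \sum_i N (e i) (e i) = 0 ->
  \sum_i << N (e i) v, e i *m J x >> = 0.
Proof.
move=> d0; transitivity << v, (\sum_i N (e i) (e i)) *m J x >>.
  rewrite mulmx_suml inner_sumr; apply: eq_bigr => i _.
  by rewrite nabJ_skew nabJ_anticomm innerNr opprK.
by rewrite d0 mul0mx inner0r.
Qed.

(* [nu i] is the derivative of the frame along a curve *)
Lemma frame_rotation (nu : 'I_n -> 'rV[R]_n) T : bilin T ->
  (forall i k, << nu i, e k >> = - << nu k, e i >>) ->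
  \sum_i (T (e i) (nu i) + T (nu i) (e i)) = 0.
Proof.
move=> bT sk.
pose c i k := << nu i, e k >>.
have E1 i : T (e i) (nu i) = \sum_k c i k * T (e i) (e k).
  rewrite [in LHS](frame_expand GJx eon (nu i)).
  have := bilin_sum (fun=> 1) (c i) (fun _ : 'I_1 => e i) e bT.
  rewrite !big_ord1 scale1r => ->.
  by apply: eq_bigr => k _; rewrite mul1r.
have E2 i : T (nu i) (e i) = \sum_k c i k * T (e k) (e i).
  rewrite [in LHS](frame_expand GJx eon (nu i)).
  have := bilin_sum (c i) (fun=> 1) e (fun _ : 'I_1 => e i) bT.
  rewrite !big_ord1 scale1r => ->.
  by apply: eq_bigr => k _; rewrite big_ord1 mulr1.
rewrite big_split /=; under eq_bigr do rewrite E1.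
rewrite [X in _ + X](_ : _ = - \sum_i \sum_k c i k * T (e i) (e k)) ?subrr //.
rewrite -sumrN; under eq_bigr do rewrite E2.
rewrite exchange_big; apply: eq_bigr => i _; rewrite -sumrN.
by apply: eq_bigr => k _; rewrite /c sk mulNr.
Qed.

End Frame.

End PointwiseGeometry.

(** * Covariant derivatives of vector fields *)

HB.lock Definition nab (R : realType) (n : nat) (G : 'rV[R]_n -> 'M[R]_n)
    (x u : 'rV[R]_n) (Z : vfield R n) : 'rV[R]_n :=
  'D_u Z x + gam G x u (Z x).

Section Fields.
Context (R : realType) (n : nat) (O : set 'rV[R]_n).
Hypothesis O_open : open O.

Lemma smooth_on_differentiable (W : normedModType R) (f : 'rV[R]_n -> W) x :
  smooth_on O f -> O x -> differentiable f x.
Proof. by move=> sf Ox; exact: (sf [::] x Ox). Qed.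

Lemma smooth_on_derive (W : normedModType R) (f : 'rV[R]_n -> W) v :
  smooth_on O f -> smooth_on O ('D_v f).
Proof. by move=> sf s x Ox; have := sf (rcons s v) x Ox; rewrite foldr_rcons. Qed.

(** Smoothness controls derivatives in fixed directions only, so the moving direction is expanded in
    coordinates, which is legitimate on the open set where [f] is differentiable. *)
Lemma differentiable_derive_along p q (f : 'rV[R]_n -> 'M[R]_(p, q))
    (X : vfield R n) x : smooth_on O f -> O x -> differentiable X x ->
  differentiable (fun y => 'D_(X y) f y) x.
Proof.
move=> sf Ox dX.
apply: (@differentiable_near _ _ _
  (fun y => \sum_k X y 0 k *: 'D_(delta_mx 0 k) f y)).
  have : \forall y \near x, O y by exact: open_nbhs_nbhs.
  apply: filterS => y Oy.
  rewrite -derive_diff_sum -?row_sum_delta //.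
  exact: smooth_on_differentiable sf Oy.
apply: differentiable_sumf => k _; apply/differentiable_mxP => i j.
under eq_fun do rewrite mxE.
apply: differentiable_mulf; first by move/differentiable_mxP : dX; apply.
have /differentiable_mxP := smooth_on_differentiable
  (smooth_on_derive (delta_mx 0 k) sf) Ox.
exact.
Qed.

Context (G J : 'rV[R]_n -> 'M[R]_n).
Hypotheses (sG : smooth_on O G) (sJ : smooth_on O J).
Hypothesis GJ : forall y, O y -> hermitian_pair (G y) (J y).

Section AtPoint.
Context (x : 'rV[R]_n).
Hypothesis Ox : O x.

Lemma near_domain : \forall y \near x, O y.
Proof. exact: open_nbhs_nbhs. Qed.

Lemma near_hermitian : \forall y \near x, hermitian_pair (G y) (J y).
Proof. exact: filterS near_domain. Qed.

Let dG : differentiable G x := smooth_on_differentiable sG Ox.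
Let dJ : differentiable J x := smooth_on_differentiable sJ Ox.
Let GJn := near_hermitian.

Lemma differentiable_gam (X Y : vfield R n) :
  differentiable X x -> differentiable Y x ->
  differentiable (fun y => gam G y (X y) (Y y)) x.
Proof.
move=> dX dY; rewrite gam.unlock; apply: differentiable_mulmx.
  apply/differentiable_mxP => i l.
  under eq_fun do rewrite mxE.
  apply: differentiable_mulcf; apply: differentiable_addf.
    apply: differentiable_addf; apply: differentiable_inner => //.
    - exact: differentiable_derive_along.
    - exact: differentiable_derive_along.
  apply: differentiableN; apply: differentiable_inner => //.
  exact: smooth_on_differentiable (smooth_on_derive _ sG) Ox.
apply: differentiable_invmx => //.
by apply: filterS GJn => y /herm_unit.
Qed.

Lemma differentiable_nab (X Z : vfield R n) :
  differentiable X x -> smooth_on O Z ->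
  differentiable (fun y => nab G y (X y) Z) x.
Proof.
move=> dX sZ; rewrite nab.unlock; apply: differentiable_addf.
  exact: differentiable_derive_along.
by apply: differentiable_gam => //; exact: smooth_on_differentiable sZ Ox.
Qed.

Lemma differentiable_nabJ (X Y : vfield R n) :
  differentiable X x -> differentiable Y x ->
  differentiable (fun y => nabJ G J y (X y) (Y y)) x.
Proof.
move=> dX dY; rewrite nabJ.unlock; apply: differentiable_addf.
  apply: differentiable_addf.
    apply: differentiable_mulmx => //.
    exact: differentiable_derive_along.
  by apply: differentiable_gam => //; exact: differentiable_mulmx.
apply: differentiableN; apply: differentiable_mulmx => //.
exact: differentiable_gam.
Qed.

Lemma nab_near u (A B : vfield R n) :
  (\forall y \near x, A y = B y) -> nab G x u A = nab G x u B.
Proof.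
move=> AB; rewrite nab.unlock (near_eq_derive _ AB).
by rewrite (nbhs_singleton AB).
Qed.

Lemma eq_nab u (A B : vfield R n) : A =1 B -> nab G x u A = nab G x u B.
Proof. by move=> /funext ->. Qed.

Lemma nabD u (A B : vfield R n) : differentiable A x -> differentiable B x ->
  nab G x u (fun y => A y + B y) = nab G x u A + nab G x u B.
Proof.
move=> dA dB; rewrite nab.unlock derive_addf // (gamD GJn dG).
exact: addrACA.
Qed.

Lemma nab0 u : nab G x u (fun=> 0) = 0.
Proof. by rewrite nab.unlock (derive_cst 0) (gam0r GJn dG) addr0. Qed.

Lemma nab_sum u (I : Type) (r : seq I) (A : I -> vfield R n) :
  (forall i, differentiable (A i) x) ->
  nab G x u (fun y => \sum_(i <- r) A i y) = \sum_(i <- r) nab G x u (A i).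
Proof.
move=> dA; elim: r => [|i r IH].
  rewrite big_nil -[RHS](nab0 u); apply: eq_nab => y.
  by rewrite big_nil.
rewrite big_cons -IH -nabD //; last by apply: differentiable_sumf => j _.
by apply: eq_nab => y; rewrite big_cons.
Qed.

Lemma nab_endo u (Z : vfield R n) : differentiable Z x ->
  nab G x u (endo J Z) = nabJ G J x u (Z x) + nab G x u Z *m J x.
Proof.
move=> dZ; rewrite nab.unlock nabJ.unlock /endo derive_mulmx // mulmxDl.
have H (a b c d : 'rV[R]_n) : a + b + c = b + c - d + (a + d).
  by rewrite [a + d]addrC addrA subrK [RHS]addrC addrA.
exact: H.
Qed.

Lemma nab_metric u (X Y : vfield R n) : differentiable X x -> differentiable Y x ->
  'D_u (fun y => inner (G y) (X y) (Y y) : R) x =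
  inner (G x) (nab G x u X) (Y x) + inner (G x) (X x) (nab G x u Y).
Proof.
move=> dX dY; rewrite derive_inner // nab.unlock innerDl innerDr.
have := metric_parallel GJn dG u (X x) (Y x); rewrite dmetric.unlock => ->.
ring.
Qed.

Lemma bracketE (X Y : vfield R n) :
  lie_bracket X Y x = nab G x (X x) Y - nab G x (Y x) X.
Proof.
rewrite nab.unlock (gam_sym GJn dG (Y x)) /lie_bracket opprD addrACA subrr.
by rewrite addr0.
Qed.

End AtPoint.
End Fields.

(** * Scalar and star-scalar curvature *)

Lemma levi_civitaE (R : realType) n (G : 'rV[R]_n -> 'M[R]_n) (X Z : vfield R n) y :
  levi_civita G X Z y = nab G y (X y) Z.
Proof. by rewrite nab.unlock gam.unlock. Qed.

Section Curvature.
Context (R : realType) (n : nat) (O : set 'rV[R]_n).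
Hypothesis O_open : open O.
Context (G J : 'rV[R]_n -> 'M[R]_n).
Hypotheses (sG : smooth_on O G) (sJ : smooth_on O J).
Hypothesis GJ : forall y, O y -> hermitian_pair (G y) (J y).
Context (x : 'rV[R]_n).
Hypothesis Ox : O x.

Let dG : differentiable G x := smooth_on_differentiable sG Ox.
Let dJ : differentiable J x := smooth_on_differentiable sJ Ox.
Let GJn := near_hermitian O_open GJ Ox.
Let GJx := GJ Ox.
Local Notation N := (nabJ G J).
Local Notation "<< u , v >>" := (inner (G x) u v).

Lemma nabla_endoE (X Y : vfield R n) : differentiable Y x ->
  nabla_endo G J X Y x = N x (X x) (Y x).
Proof.
move=> dY; rewrite /nabla_endo {2}/endo !levi_civitaE.
by rewrite (nab_endo _ sJ Ox) // addrK.
Qed.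

Lemma nab_nab_endo u (Y Z : vfield R n) : smooth_on O Y -> smooth_on O Z ->
  nab G x u (levi_civita G Y (endo J Z)) =
  nab G x u (fun y => N y (Y y) (Z y)) + N x u (nab G x (Y x) Z)
  + nab G x u (levi_civita G Y Z) *m J x.
Proof.
move=> sY sZ.
have dY := smooth_on_differentiable sY Ox.
have dZ := smooth_on_differentiable sZ Ox.
have dnab := differentiable_nab O_open sG GJ Ox dY sZ.
rewrite (@nab_near _ _ _ _ _ _ (fun y => N y (Y y) (Z y) +
   endo J (fun z => nab G z (Y z) Z) y)); last first.
  apply: filterS (near_domain O_open Ox) => y Oy.
  rewrite levi_civitaE (nab_endo _ sJ Oy) //.
  exact: smooth_on_differentiable sZ Oy.
rewrite (nabD O_open sG GJ Ox); first last.
- exact: differentiable_mulmx.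
- exact: (differentiable_nabJ O_open sG sJ GJ Ox).
rewrite (nab_endo _ sJ Ox) // addrA; congr (_ + _ *m _).
by apply: eq_nab => y; rewrite levi_civitaE.
Qed.

(** The Ricci identity, with the second derivatives of [J] left as derivatives of the fields [N_Y Z]
    and [N_X Z], ready for differentiating traces of [N]. *)
Lemma curvature_endo (X Y Z : vfield R n) :
  smooth_on O X -> smooth_on O Y -> smooth_on O Z ->
  curvature G X Y (endo J Z) x = curvature G X Y Z x *m J x +
   (- nab G x (X x) (fun y => N y (Y y) (Z y)) - N x (X x) (nab G x (Y x) Z)
    + nab G x (Y x) (fun y => N y (X y) (Z y)) + N x (Y x) (nab G x (X x) Z)
    + N x (lie_bracket X Y x) (Z x)).
Proof.
move=> sX sY sZ; rewrite /curvature.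
rewrite !levi_civitaE.
rewrite (nab_nab_endo (X x) sY sZ).
rewrite (nab_nab_endo (Y x) sX sZ).
rewrite (nab_endo _ sJ Ox); last exact: smooth_on_differentiable sZ Ox.
rewrite !mulmxDl mulNmx.
have H (a b c d e f g h : 'rV[R]_n) :
    - (a + b + c) + (d + e + f) + (g + h) =
    - c + f + h + (- a - b + d + e + g).
  rewrite !opprD; apply/rowP => i; rewrite !mxE; ring.
exact: H.
Qed.

Section Frame.
Context (e : 'I_n -> vfield R n).
Hypothesis se : forall i, smooth_on O (e i).
Hypothesis eon : forall y i j, O y -> inner (G y) (e i y) (e j y) = (i == j)%:R.
Hypothesis div0 : forall y, O y -> \sum_i N y (e i y) (e i y) = 0.

Let de i : differentiable (e i) x := smooth_on_differentiable (se i) Ox.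
Let eonx i j : << e i x, e j x >> = (i == j)%:R := eon i j Ox.

Lemma frame_nab_skew u i k :
  << nab G x u (e i), e k x >> = - << nab G x u (e k), e i x >>.
Proof.
have := nab_metric O_open sG GJ Ox u (de i) (de k).
rewrite (@near_eq_derive _ _ _ _ (cst ((i == k)%:R : R))); last first.
  by apply: filterS (near_domain O_open Ox) => y Oy; rewrite eon.
rewrite derive_cst (herm_sym GJx (e i x)) => /esym/eqP.
by rewrite addr_eq0 => /eqP.
Qed.

Lemma nabJ_bilin w : bilin (fun u v => << N x u v, w >>).
Proof.
split=> a u v z.
  by rewrite (nabJ_linl GJn dG dJ) innerDl innerZl.
by rewrite (nabJ_linr GJn dG) innerDl innerZl.
Qed.

(** Apply [curvature_endo] with [X = Z = e i], [Y = e j] and pair with [e j *m J]. The part that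
    commutes with [J] gives the scalar curvature; the bracket splits into [t5] and [t6] by absence
    of torsion. *)
Lemma curvature_defect :
  (\sum_i \sum_j << curvature G (e i) (e j) (endo J (e i)) x, endo J (e j) x >>)
  - \sum_i \sum_j << curvature G (e i) (e j) (e i) x, e j x >> =
  \sum_i \sum_j << N x (e j x) (e i x), N x (e i x) (e j x) >>.
Proof.
rewrite -sumrB.
pose u i := e i x.
pose nu i j := nab G x (u i) (e j).
pose NN i j := fun y => N y (e i y) (e j y).
have dNN i j : differentiable (NN i j) x.
  exact: (differentiable_nabJ O_open sG sJ GJ Ox).
pose t1 i j := << nab G x (u i) (NN j i), u j *m J x >>.
pose t2 i j := << N x (u i) (nu j i), u j *m J x >>.
pose t3 i j := << nab G x (u j) (NN i i), u j *m J x >>.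
pose t4 i j := << N x (u j) (nu i i), u j *m J x >>.
pose t5 i j := << N x (nu i j) (u i), u j *m J x >>.
pose t6 i j := << N x (nu j i) (u i), u j *m J x >>.
transitivity (\sum_i \sum_j (- t1 i j + t5 i j) - \sum_i \sum_j (t2 i j + t6 i j)
   + \sum_i \sum_j t3 i j + \sum_i \sum_j t4 i j).
  rewrite -sumrB -!big_split /=; apply: eq_bigr => i _.
  rewrite -!sumrB -!big_split /=; apply: eq_bigr => j _.
  rewrite curvature_endo // /endo innerDl (herm_acs GJx) [LHS]addrAC subrr add0r.
  rewrite !innerDl !innerNl (bracketE O_open sG GJ Ox).
  have -> : N x (nab G x (e i x) (e j) - nab G x (e j x) (e i)) (e i x) =
    N x (nu i j) (u i) - N x (nu j i) (u i).
    have := nabJ_linl GJn dG dJ (-1) (u i) (nu j i) (nu i j).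
    by rewrite !scaleN1r addrC => ->; rewrite addrC.
  rewrite innerBl /t1 /t2 /t3 /t4 /t5 /t6; ring.
(* Covariant derivative along [u j] of the identically zero field [div0]. *)
have -> : \sum_i \sum_j t3 i j = 0.
  rewrite exchange_big big1 // => j _; rewrite /t3 -inner_suml.
  rewrite -(nab_sum O_open sG GJ Ox) //.
  rewrite (@nab_near _ _ _ _ _ _ (fun=> 0)) ?(nab0 O_open sG GJ Ox) ?inner0l //.
  by apply: filterS (near_domain O_open Ox) => y; exact: div0.
have cod v : \sum_j << N x (u j) v, u j *m J x >> = 0.
  by apply: (codifferential_tensor GJn dG dJ); exact: div0.
have -> : \sum_i \sum_j t4 i j = 0 by apply: big1 => i _; exact: cod.
(* For fixed [j], both slots of the trace over [i] are varied by the rotation of the frame along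
   [u j]. *)
have -> : \sum_i \sum_j (t2 i j + t6 i j) = 0.
  rewrite exchange_big big1 // => j _.
  apply: (frame_rotation GJn eonx (nabJ_bilin (u j *m J x))) => i k.
  exact: frame_nab_skew.
rewrite subr0 !addr0; apply: eq_bigr => i _.
(* The derivative along [u i] of the trace against [J], which vanishes on all of [O];
   differentiating the factor [J] creates the quadratic term. *)
have E1 : \sum_j (t1 i j + (<< N x (u j) (u i), N x (u i) (u j) >> +
     << N x (u j) (u i), nu i j *m J x >>)) = 0.
  transitivity ('D_(u i) (fun y => \sum_j inner (G y) (NN j i y) (endo J (e j) y) : R) x).
    have dJe j : differentiable (endo J (e j)) x by exact: differentiable_mulmx.
    rewrite derive_sumf => [|j _]; last exact: differentiable_inner.
    apply: eq_bigr => j _; rewrite (nab_metric O_open sG GJ Ox) //.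
    by rewrite (nab_endo _ sJ Ox) // innerDr.
  rewrite (@near_eq_derive _ _ _ _ (cst (0 : R))) ?derive_cst //.
  apply: filterS (near_domain O_open Ox) => y Oy.
  apply: (codifferential_tensor (near_hermitian O_open GJ Oy)).
  - exact: smooth_on_differentiable sG Oy.
  - exact: smooth_on_differentiable sJ Oy.
  - exact: div0.
(* Frame rotation along [u i] removes what [E1] leaves besides the quadratic term, together with
   [t5]. *)
have E2 : \sum_j (<< N x (u j) (u i), nu i j *m J x >> + t5 i j) = 0.
  have bT : bilin (fun a b => << N x a (u i), b *m J x >>).
    split=> a v w z; first by rewrite (nabJ_linl GJn dG dJ) innerDl innerZl.
    by rewrite mulmxDl -scalemxAl innerDr innerZr.
  apply: (frame_rotation GJn eonx bT) => j k; exact: frame_nab_skew.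
move: E1 E2; rewrite !big_split /= !sumrN => E1 E2; lra.
Qed.

Lemma curvature_defect_le :
  `| \sum_i \sum_j << curvature G (e i) (e j) (e i) x, e j x >> -
     \sum_i \sum_j << curvature G (e i) (e j) (endo J (e i)) x, endo J (e j) x >> |
  <= \sum_i \sum_j << nabla_endo G J (e i) (e j) x, nabla_endo G J (e i) (e j) x >>.
Proof.
rewrite distrC curvature_defect.
under [leRHS]eq_bigr do under eq_bigr do rewrite !nabla_endoE //.
pose A i j := N x (e i x) (e j x).
(* This symmetric form suffices: exchanging [i] and [j] shows that both squared terms sum to the
   same norm, hence the constant 1. *)
have CS (a b : 'rV[R]_n) : `| << a, b >> | <= 2^-1 * (<< a, a >> + << b, b >>).
  have := herm_ge0 GJx (a + b); have := herm_ge0 GJx (a - b).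
  rewrite !innerDl !innerDr !innerNl !innerNr (herm_sym GJx b a) => h1 h2.
  by rewrite ler_norml; apply/andP; split; lra.
apply: le_trans (ler_norm_sum _ _ _) _.
apply: (@le_trans _ _ (\sum_i \sum_j
    2^-1 * (<< A j i, A j i >> + << A i j, A i j >>))).
  apply: ler_sum => i _; apply: le_trans (ler_norm_sum _ _ _) _.
  by apply: ler_sum => j _; exact: CS.
have -> : \sum_i \sum_j 2^-1 * (<< A j i, A j i >> + << A i j, A i j >>) =
  2^-1 * (\sum_i \sum_j << A j i, A j i >> + \sum_i \sum_j << A i j, A i j >>).
  rewrite -big_split mulr_sumr; apply: eq_bigr => i _.
  by rewrite -big_split mulr_sumr.
rewrite [X in X + _]exchange_big /=.
by rewrite -[X in X + X]mul1r -mulrDl mulrA; lra.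
Qed.

End Frame.
End Curvature.

(** Inside the open chart image, the image of [U] is its preimage under the continuous inverse
    chart. *)
Lemma chart_image_open (R : realType) n (M : smoothManifold R n) (a : chart M)
    (U : set M) : open U -> U `<=` chart_dom a -> open (chart_map a @` U).
Proof.
move=> oU Ua.
have ci := @chart_inv_continuous _ _ M a.
rewrite continuous_open_subspace in ci; last exact: chart_img_open.
have -> : chart_map a @` U =
    chart_map a @` chart_dom a `&` chart_inv a @^-1` U.
  apply/seteqP; split=> [_ [q Uq <-]|_ [[q aq <-]]] /=.
    by split; [exists q => //; exact: Ua|rewrite /= chart_mapK //; exact: Ua].
  by rewrite chart_mapK // => Uq; exists q.
rewrite openE => z [az Uz]; apply: filterI.
  by apply: open_nbhs_nbhs; split=> //; exact: chart_img_open.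
by apply: (ci z); [exact: mem_set|exact: open_nbhs_nbhs].
Qed.

Theorem theorem5p6 (R : realType) (m : nat) (M : almostHermitian R m)
    (m_gt0 : (0 < m)%N)
    (M_compact : compact [set: M])
    (M_balanced : balanced M)
    (a : chart M) (U : set M) (e : 'I_(m.*2) -> vfield R m.*2)
    (U_open : open U) (U_dom : U `<=` chart_dom a)
    (e_frame : orthonormal_frame a U e)
    (p : M) (Up : U p) :
  `| scalar_curvature a e p - star_scalar_curvature a e p |
    <= nabla_acs_sqnorm a e p.
Proof.
(* Writing [m = k.+1] turns the exponent [m.-1] into [k] and the dimension into [k.+1.*2], as in the
   cofactor lemmas. *)
case: m M m_gt0 M_compact M_balanced a U e U_open U_dom e_frame p Up
  => // k M _ _ [_ closed] a U e U_open U_dom [se eon] p Up.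
pose O := chart_map a @` U.
have O_open : open O by exact: chart_image_open.
have O_img : O `<=` chart_img a.
  by move=> _ [q Uq <-]; exists q => //; exact: U_dom.
have sG : smooth_on O (metric a).
  by move=> s y /O_img; exact: metric_smooth.
have sJ : smooth_on O (acs a).
  by move=> s y /O_img; exact: acs_smooth.
have GJ y : O y -> hermitian_pair (metric a y) (acs a y).
  move=> /O_img ay; split=> [u v|u|u|u v].
  - exact: Defs.metric_sym.
  - exact: metric_pos.
  - exact: acs_square.
  - exact: metric_acs.
have eonO y i j : O y -> inner (metric a y) (e i y) (e j y) = (i == j)%:R.
  by move=> [q Uq <-]; exact: eon.
have Op : O (chart_map a p) by exists p.
(* What remains is the vanishing trace at every [y] of [O], to which the pointwise argument
   applies. *)
apply: (curvature_defect_le O_open sG sJ GJ Op se eonO) => y Oy.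
have dG := smooth_on_differentiable sG Oy.
have dJ := smooth_on_differentiable sJ Oy.
have GJn := near_hermitian O_open GJ Oy.
apply: (codifferential_eq0 GJn dG dJ (fun i j => eonO y i j Oy)).
apply: (balanced_trace GJn dG dJ _ (fun i j => eonO y i j Oy)) => v.
by case: Oy => q Uq <-; apply: closed; exact: U_dom.
Qed.
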